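(* Let $\tau\in\mathbb{C}$ with $\mathrm{Im}(\tau)>0$, let $q=e^{\pi i\tau}$ and $\tau'=-1/\tau$. For every complex number $z$, \[ \theta_1^2(2z\mid\tau')\,\theta_1^4\!\left(\tfrac{\pi}{2}\,\big|\,\tfrac{\tau'}{2}\right)\theta_1^2\!\left(\tfrac{\pi}{2}\,\big|\,\tfrac{\tau'}{4}\right) =\left(\frac12\frac{\Pi_q}{\Pi_{q^4}}\right)^2\theta_1^2\!\left(z\,\big|\,\tfrac{\tau'}{4}\right)\theta_1^4\!\left(\tfrac{\pi}{2}\,\big|\,\tfrac{\tau'}{2}\right)\theta_1^2\!\left(\tfrac{\pi}{2}\,\big|\,\tau'\right) -\left(\frac12\frac{\Pi_q}{\Pi_{q^4}}\right)^2\theta_1^4\!\left(z\,\big|\,\tfrac{\tau'}{2}\right)\theta_1^2\!\left(\tfrac{\pi}{2}\,\big|\,\tfrac{\tau'}{4}\right)\theta_1^2\!\left(\tfrac{\pi}{2}\,\big|\,\tau'\right). \]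
   Context: For $\sigma\in\mathbb{C}$ with $\mathrm{Im}(\sigma)>0$ and $z\in\mathbb{C}$, the first Jacobi theta function is \[ \theta_1(z\mid\sigma)=2\sum_{n=0}^{\infty}(-1)^n e^{\pi i\sigma(2n+1)^2/4}\sin((2n+1)z), \] and $\theta_1^m(z\mid\sigma)$ denotes its $m$-th power. For $|q|<1$, $(a;q)_\infty=\prod_{i=0}^{\infty}(1-aq^i)$. With $q=e^{\pi i\tau}$, \[ \Pi_q=q^{1/4}\frac{(q^2;q^2)_\infty^2}{(q;q^2)_\infty^2}, \] and for a positive integer $m$, $\Pi_{q^m}$ is the same expression with $q$ replaced by $q^m=e^{\pi i m\tau}$ (that is, $\tau$ replaced by $m\tau$). Fractional powers of $q$ are understood as $q^a=e^{\pi i\tau a}$. *)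

(* Defs.v *)
From Stdlib Require Import Reals.
From Coquelicot Require Export Coquelicot.
Open Scope C_scope.

Definition Cexp (z : C) : C :=
  (exp (Re z) * cos (Im z), exp (Re z) * sin (Im z))%R.

Definition Csin (z : C) : C := (Cexp (Ci * z) - Cexp (- (Ci * z))) / (2 * Ci).

(* Componentwise limit; it is the limit in C whenever [u] converges, and is
   unspecified otherwise, as for [Lim_seq]. *)
Definition CLim_seq (u : nat -> C) : C :=
  (real (Lim_seq (fun n => Re (u n))), real (Lim_seq (fun n => Im (u n)))).

Lemma CLim_seq_correct (u : nat -> C) (l : C) :
  filterlim u eventually (locally l) -> CLim_seq u = l.
Proof.
intros H; destruct l as [x y]; unfold CLim_seq; f_equal.
- rewrite (is_lim_seq_unique _ (Finite x)); [reflexivity|].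
  intros P [e He].
  refine (H (fun w : C => P (Re w)) _).
  exists e; intros w [Hw _]; exact (He _ Hw).
- rewrite (is_lim_seq_unique _ (Finite y)); [reflexivity|].
  intros P [e He].
  refine (H (fun w : C => P (Im w)) _).
  exists e; intros w [_ Hw]; exact (He _ Hw).
Qed.

Definition CSeries (a : nat -> C) : C := CLim_seq (sum_n a).

Fixpoint Cprod_n (f : nat -> C) (n : nat) : C :=
  match n with
  | O => 1
  | S k => Cprod_n f k * f k
  end.

Definition CProd_inf (f : nat -> C) : C := CLim_seq (Cprod_n f).

Definition qPochhammer (a q : C) : C := CProd_inf (fun i => 1 - a * q ^ i).

(* The series converges when 0 < Im sigma. *)
Definition theta1 (z sigma : C) : C :=
  2 * CSeries (fun n =>
    (- (1)) ^ n
    * Cexp (PI * Ci * sigma * (2 * INR n + 1) ^ 2 / 4)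
    * Csin ((2 * INR n + 1) * z)).

(* q ^ a for q = e^(pi i tau): the branch is fixed by tau, not by the number q *)
Definition qpow (tau a : C) : C := Cexp (PI * Ci * tau * a).

(* Pi_q for q = e^(pi i tau); as q ^ (1/4) depends on tau, it is a function of
   tau, and Pi_(q^m) is [PiQ (m * tau)]. *)
Definition PiQ (tau : C) : C :=
  let q := Cexp (PI * Ci * tau) in
  qpow tau (1 / 4)
  * (qPochhammer (q ^ 2) (q ^ 2) ^ 2 / qPochhammer q (q ^ 2) ^ 2).

(* Main.v *)
Require Import Defs.
From Stdlib Require Import Reals Lra Lia List Permutation ZArith.
From Stdlib Require Import Classical ClassicalEpsilon.
From Coquelicot Require Import Coquelicot.
Open Scope C_scope.

(** Write [w = tau' / 2] and [z = PI * x]. Up to sign, [theta1] is the theta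
    series with characteristic 1/2 shifted by 1/2 ([theta1_Theta]), and the
    other three Jacobi functions [theta_2], [theta_3], [theta_4] are the values
    of the same family [Theta].

    For fixed [tau] the identity is an algebraic consequence of doubling
    formulas. The function [theta_1 (2 x)] of period [2 w] is a multiple of
    [theta_1 theta_2] of period [w], and [theta_1] of period [w / 2] is a
    multiple of [theta_1 theta_4] of period [w]. After division by
    [theta_1 ^ 2] the claim becomes the classical relation
    [theta_2 ^ 2 (x) theta_4 ^ 2 = theta_4 ^ 2 (x) theta_2 ^ 2
     - theta_1 ^ 2 (x) theta_3 ^ 2] between squares of theta functions of period
    [w] ([jacobi_quadratic]). All of these relations are instances of a single
    product formula, [Theta_mul]: a product of two theta series is a double sum
    over pairs of integers, which is rearranged along the sum and the
    difference of the two indices.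

    What remains is the constant. Gauss's product, a case of the triple product
    identity ([triple_product], [PiQ_theta]), gives
    [PiQ tau = theta_2 (0 | tau / 2) ^ 2 / 4], so that [PiQ tau / PiQ (4 tau)]
    is a ratio of theta constants of period [tau], homogeneous of degree zero.
    The other constants have period [tau' = - 1 / tau]; hence the inversion
    formula enters, but only up to a common factor: [theta_2, theta_3, theta_4]
    at [tau] are proportional to [theta_4, theta_3, theta_2] at [tau']
    ([theta_inversion]).

    The inversion formula is proved without integrals. Sample the Gaussian
    [E (t * x ^ 2)] on the mesh [1 / N] and apply finite Fourier inversion
    ([gfourier_inversion]). By completing the square, the [k]-th discrete
    Fourier coefficient is [E (- k ^ 2 / t)] times a Riemann sum of the Gaussian
    along the line through [- k / t]. As [N] grows these Riemann sums become
    independent of the line ([gsum_translation_limit]), and summation by parts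
    bounds the coefficients by a multiple of [1 / k ^ 2] uniformly in [N]
    ([gfourier_decay]); dominated convergence concludes. The limit of the
    Riemann sums, a Gaussian integral, is the common factor and never has to be
    computed. The triple product also shows that no theta constant vanishes,
    which justifies all divisions. *)

(** * Limits of complex sequences *)

Definition Clim (u : nat -> C) (l : C) : Prop :=
  forall eps : R, (0 < eps)%R ->
  exists N, forall n, (N <= n)%nat -> (Cmod (u n - l) < eps)%R.

Lemma Cmod_le_sum (z : C) : (Cmod z <= Rabs (Re z) + Rabs (Im z))%R.
Proof.
  destruct z as [x y].
  replace (x, y) with (RtoC x + Ci * RtoC y)
    by (apply injective_projections; simpl; ring).
  eapply Rle_trans; [apply Cmod_triangle|].
  rewrite Cmod_mult, Cmod_Ci, !Cmod_R; simpl.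
  apply Req_le; f_equal; [f_equal; ring|].
  rewrite Rmult_1_l; f_equal; ring.
Qed.

Lemma Cmod_triangle_sub (x y z : C) : (Cmod (x - z) <= Cmod (x - y) + Cmod (y - z))%R.
Proof. replace (x - z) with ((x - y) + (y - z)) by ring; apply Cmod_triangle. Qed.

Lemma Cmod_sub_sym (x y : C) : Cmod (x - y) = Cmod (y - x).
Proof. replace (x - y) with (- (y - x)) by ring; apply Cmod_opp. Qed.

Lemma Ceq_of_dist_lt (x y : C) :
  (forall eps : R, (0 < eps)%R -> (Cmod (x - y) < eps)%R) -> x = y.
Proof.
  intros H; apply Ceq_minus, Cmod_eq_0.
  destruct (Rle_lt_or_eq_dec 0 (Cmod (x - y)) (Cmod_ge_0 _)) as [h|h]; [|easy].
  specialize (H _ h); lra.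
Qed.

Lemma Clim_ext (u v : nat -> C) (l : C) :
  (forall n, u n = v n) -> Clim u l -> Clim v l.
Proof.
  intros H Hu e he; destruct (Hu e he) as [N HN]; exists N; intros n hn.
  rewrite <- H; auto.
Qed.

Lemma Clim_unique (u : nat -> C) (l l' : C) : Clim u l -> Clim u l' -> l = l'.
Proof.
  intros H H'; apply Ceq_of_dist_lt; intros e he.
  destruct (H (e / 2)%R) as [N HN]; [lra|]; destruct (H' (e / 2)%R) as [N' HN']; [lra|].
  specialize (HN (max N N') (Nat.le_max_l _ _)).
  specialize (HN' (max N N') (Nat.le_max_r _ _)).
  pose proof (Cmod_triangle_sub l (u (max N N')) l') as T.
  rewrite (Cmod_sub_sym l (u _)) in T; lra.
Qed.

Lemma Clim_const (c : C) : Clim (fun _ => c) c.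
Proof.
  intros e he; exists 0%nat; intros n _.
  replace (c - c) with (RtoC 0) by ring; rewrite Cmod_0; exact he.
Qed.

Lemma Clim_plus (u v : nat -> C) (l m : C) :
  Clim u l -> Clim v m -> Clim (fun n => u n + v n) (l + m).
Proof.
  intros H H' e he.
  destruct (H (e / 2)%R) as [N HN]; [lra|]; destruct (H' (e / 2)%R) as [N' HN']; [lra|].
  exists (max N N'); intros n hn.
  replace (u n + v n - (l + m)) with ((u n - l) + (v n - m)) by ring.
  eapply Rle_lt_trans; [apply Cmod_triangle|].
  specialize (HN n ltac:(lia)); specialize (HN' n ltac:(lia)); lra.
Qed.

Lemma Clim_bounded (u : nat -> C) (l : C) :
  Clim u l -> exists M, (0 < M)%R /\ forall n, (Cmod (u n) <= M)%R.
Proof.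
  intros H; destruct (H 1%R) as [N HN]; [lra|].
  assert (forall K, exists M, (0 < M)%R /\ forall n, (n < K)%nat -> (Cmod (u n) <= M)%R) as B.
  { induction K as [|K [M [h0 h]]]; [exists 1%R; split; [lra|intros; lia]|].
    exists (Rmax M (Cmod (u K))); split; [eapply Rlt_le_trans; [exact h0|apply Rmax_l]|].
    intros n hn; destruct (Nat.eq_dec n K) as [->|]; [apply Rmax_r|].
    eapply Rle_trans; [apply h; lia|apply Rmax_l]. }
  destruct (B N) as [M [h0 h]].
  exists (M + (Cmod l + 1))%R; pose proof (Cmod_ge_0 l); split; [lra|].
  intros n; destruct (Nat.lt_ge_cases n N) as [hn|hn]; [specialize (h n hn); lra|].
  specialize (HN n hn).
  pose proof (Cmod_triangle (u n - l) l) as T.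
  replace (u n - l + l) with (u n) in T by ring; lra.
Qed.

Lemma Clim_0_mult (u v : nat -> C) (M : R) :
  Clim u 0 -> (forall n, (Cmod (v n) <= M)%R) -> Clim (fun n => u n * v n) 0.
Proof.
  intros H Hv e he.
  assert (0 <= M)%R as hM by (eapply Rle_trans; [apply Cmod_ge_0|apply (Hv 0%nat)]).
  destruct (H (e / (M + 1))%R) as [N HN]; [apply Rdiv_lt_0_compat; lra|].
  exists N; intros n hn; specialize (HN n hn).
  replace (u n * v n - 0) with ((u n - 0) * v n) by ring; rewrite Cmod_mult.
  apply Rle_lt_trans with (Cmod (u n - 0) * (M + 1))%R.
  - apply Rmult_le_compat_l; [apply Cmod_ge_0|]; specialize (Hv n); lra.
  - replace e with (e / (M + 1) * (M + 1))%R by (field; lra).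
    apply Rmult_lt_compat_r; lra.
Qed.

Lemma Clim_sub_0 (u : nat -> C) (l : C) : Clim u l <-> Clim (fun n => u n - l) 0.
Proof.
  split; intros H e he; destruct (H e he) as [N HN]; exists N; intros n hn;
    specialize (HN n hn); [replace (u n - l - 0) with (u n - l) by ring
                          |replace (u n - l) with (u n - l - 0) by ring]; exact HN.
Qed.

Lemma Clim_mult (u v : nat -> C) (l m : C) :
  Clim u l -> Clim v m -> Clim (fun n => u n * v n) (l * m).
Proof.
  intros H H'; destruct (Clim_bounded _ _ H') as [M [_ hM]].
  apply (proj2 (Clim_sub_0 _ _)).
  apply Clim_ext with (fun n => (u n - l) * v n + (v n - m) * l); [intros; ring|].
  replace (RtoC 0) with (RtoC 0 + RtoC 0) by ring.
  apply Clim_plus.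
  - apply Clim_0_mult with M; [apply (proj1 (Clim_sub_0 _ _))|]; assumption.
  - apply Clim_0_mult with (Cmod l); [apply (proj1 (Clim_sub_0 _ _)); assumption|intros; lra].
Qed.

Lemma Clim_opp (u : nat -> C) (l : C) : Clim u l -> Clim (fun n => - u n) (- l).
Proof.
  intros H; replace (- l) with (- (1) * l) by ring.
  apply Clim_ext with (fun n => - (1) * u n); [intros; ring|].
  apply Clim_mult; [apply Clim_const|exact H].
Qed.

Lemma Clim_minus (u v : nat -> C) (l m : C) :
  Clim u l -> Clim v m -> Clim (fun n => u n - v n) (l - m).
Proof. intros H H'; apply Clim_plus; [exact H|apply Clim_opp, H']. Qed.

Lemma Clim_eventually (u v : nat -> C) (l : C) (n0 : nat) :
  (forall n, (n0 <= n)%nat -> u n = v n) -> Clim u l -> Clim v l.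
Proof.
  intros H Hu e he; destruct (Hu e he) as [N HN]; exists (n0 + N)%nat; intros n hn.
  rewrite <- H by lia; apply HN; lia.
Qed.

Lemma Clim_subseq (u : nat -> C) (l : C) (s : nat -> nat) :
  (forall N, exists n0, forall n, (n0 <= n)%nat -> (N <= s n)%nat) ->
  Clim u l -> Clim (fun n => u (s n)) l.
Proof.
  intros hs H e he; destruct (H e he) as [N HN]; destruct (hs N) as [n0 h].
  exists n0; intros n hn; apply HN, h, hn.
Qed.

Lemma Clim_inv (u : nat -> C) (l : C) :
  l <> 0 -> (forall n, u n <> 0) -> Clim u l -> Clim (fun n => / u n) (/ l).
Proof.
  intros hl hu H eps heps.
  assert (0 < Cmod l)%R as hcl by (apply Cmod_gt_0, hl).
  set (b := (eps * (Cmod l * Cmod l / 2))%R).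
  destruct (H (Rmin (Cmod l / 2) b)) as [N HN].
  { apply Rmin_glb_lt; [lra|]; apply Rmult_lt_0_compat; nra. }
  exists N; intros n hn; specialize (HN n hn).
  pose proof (Rmin_l (Cmod l / 2) b); pose proof (Rmin_r (Cmod l / 2) b).
  assert (Cmod l / 2 <= Cmod (u n))%R as hge.
  { pose proof (Cmod_triangle (u n) (l - u n)) as T.
    replace (u n + (l - u n)) with l in T by ring.
    rewrite (Cmod_sub_sym l) in T; lra. }
  replace (/ u n - / l) with (- (u n - l) / (u n * l)) by (field; split; auto).
  rewrite Cmod_div, Cmod_opp, Cmod_mult by (apply Cmult_neq_0; auto).
  assert (0 < Cmod (u n) * Cmod l)%R as hpos by (apply Rmult_lt_0_compat; lra).
  apply Rmult_lt_reg_r with (Cmod (u n) * Cmod l)%R; [exact hpos|].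
  unfold Rdiv; rewrite Rmult_assoc, Rinv_l, Rmult_1_r by lra.
  apply Rlt_le_trans with b; [lra|]; unfold b.
  apply Rmult_le_compat_l; nra.
Qed.

Lemma Clim_le (u : nat -> C) (l : C) (b : R) :
  Clim u l -> (forall n, (Cmod (u n) <= b)%R) -> (Cmod l <= b)%R.
Proof.
  intros H Hb; apply Rnot_lt_le; intros h.
  destruct (H (Cmod l - b)%R) as [N HN]; [lra|].
  specialize (HN N (Nat.le_refl _)); specialize (Hb N).
  pose proof (Cmod_triangle (l - u N) (u N)) as T.
  replace (l - u N + u N) with l in T by ring.
  rewrite Cmod_sub_sym in T; lra.
Qed.

Lemma Clim_ge (u : nat -> C) (l : C) (b : R) :
  Clim u l -> (forall n, (b <= Cmod (u n))%R) -> (b <= Cmod l)%R.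
Proof.
  intros H Hb; apply Rnot_lt_le; intros h.
  destruct (H (b - Cmod l)%R) as [N HN]; [lra|].
  specialize (HN N (Nat.le_refl _)); specialize (Hb N).
  pose proof (Cmod_triangle (u N - l) l) as T.
  replace (u N - l + l) with (u N) in T by ring; lra.
Qed.

(** Componentwise limits agree with limits for the modulus, so that a limit
    in the latter sense evaluates [CLim_seq]. *)
Lemma CLim_seq_of_Clim (u : nat -> C) (l : C) : Clim u l -> CLim_seq u = l.
Proof.
  intros H; apply CLim_seq_correct; intros P [e He].
  destruct (H e (cond_pos e)) as [N HN]; exists N; intros n hn.
  apply He, C_NormedModule_mixin_compat1, (HN n hn).
Qed.

(** * Unordered sums of complex families *)

Definition lsum {I : Type} (f : I -> C) (l : list I) : C :=
  fold_right (fun i s => f i + s) 0 l.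

Definition lsumR {I : Type} (b : I -> R) (l : list I) : R :=
  fold_right (fun i s => b i + s)%R 0%R l.

Definition summable {I : Type} (f : I -> C) : Prop :=
  exists M : R, forall l, NoDup l -> (lsumR (fun i => Cmod (f i)) l <= M)%R.

(** Absolute summability is part of the notion, so that products and
    reindexings of sums need no separate convergence hypothesis. *)
Definition has_sum {I : Type} (f : I -> C) (s : C) : Prop :=
  summable f /\
  forall eps : R, (0 < eps)%R ->
  exists L, forall l, NoDup l -> incl L l -> (Cmod (lsum f l - s) < eps)%R.

(** Meaningful only for summable families, see [summable_has_sum]. *)
Definition tsum {I : Type} (f : I -> C) : C := epsilon (inhabits (RtoC 0)) (has_sum f).

Lemma lsum_cons {I} (f : I -> C) (a : I) (l : list I) : lsum f (a :: l) = f a + lsum f l.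
Proof. easy. Qed.

Lemma lsum_one {I} (f : I -> C) (a : I) : lsum f (a :: nil) = f a.
Proof. simpl; ring. Qed.

Lemma lsum_app {I} (f : I -> C) (l1 l2 : list I) :
  lsum f (l1 ++ l2) = lsum f l1 + lsum f l2.
Proof. induction l1 as [|a l1 IH]; simpl; [ring|rewrite IH; ring]. Qed.

Lemma lsumR_app {I} (b : I -> R) (l1 l2 : list I) :
  lsumR b (l1 ++ l2) = (lsumR b l1 + lsumR b l2)%R.
Proof. induction l1 as [|a l1 IH]; simpl; [ring|rewrite IH; ring]. Qed.

Lemma lsum_perm {I} (f : I -> C) (l1 l2 : list I) :
  Permutation l1 l2 -> lsum f l1 = lsum f l2.
Proof. induction 1; simpl; try congruence; ring. Qed.

Lemma lsumR_perm {I} (b : I -> R) (l1 l2 : list I) :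
  Permutation l1 l2 -> lsumR b l1 = lsumR b l2.
Proof. induction 1; simpl; try congruence; ring. Qed.

Lemma lsum_ext_in {I} (f g : I -> C) (l : list I) :
  (forall i, In i l -> f i = g i) -> lsum f l = lsum g l.
Proof.
  induction l as [|a l IH]; simpl; intros H; [easy|].
  rewrite (H a), IH; auto.
Qed.

Lemma lsum_0_in {I} (f : I -> C) (l : list I) :
  (forall i, In i l -> f i = 0) -> lsum f l = 0.
Proof.
  induction l as [|a l IH]; simpl; intros H; [easy|].
  rewrite (H a), IH; auto; ring.
Qed.

Lemma lsum_plus {I} (f g : I -> C) (l : list I) :
  lsum (fun i => f i + g i) l = lsum f l + lsum g l.
Proof. induction l as [|a l IH]; simpl; [ring|rewrite IH; ring]. Qed.

Lemma lsum_scal {I} (c : C) (f : I -> C) (l : list I) :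
  lsum (fun i => c * f i) l = c * lsum f l.
Proof. induction l as [|a l IH]; simpl; [ring|rewrite IH; ring]. Qed.

Lemma lsum_map {I J} (e : I -> J) (f : J -> C) (l : list I) :
  lsum f (map e l) = lsum (fun i => f (e i)) l.
Proof. induction l as [|a l IH]; simpl; [easy|rewrite IH; easy]. Qed.

Lemma lsumR_map {I J} (e : I -> J) (b : J -> R) (l : list I) :
  lsumR b (map e l) = lsumR (fun i => b (e i)) l.
Proof. induction l as [|a l IH]; simpl; [easy|rewrite IH; easy]. Qed.

Lemma lsumR_plus {I} (b c : I -> R) (l : list I) :
  lsumR (fun i => b i + c i)%R l = (lsumR b l + lsumR c l)%R.
Proof. induction l as [|a l IH]; simpl; [ring|rewrite IH; ring]. Qed.

Lemma lsumR_scal {I} (c : R) (b : I -> R) (l : list I) :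
  lsumR (fun i => c * b i)%R l = (c * lsumR b l)%R.
Proof. induction l as [|a l IH]; simpl; [ring|rewrite IH; ring]. Qed.

Lemma lsumR_le {I} (b c : I -> R) (l : list I) :
  (forall i, In i l -> (b i <= c i)%R) -> (lsumR b l <= lsumR c l)%R.
Proof.
  induction l as [|a l IH]; simpl; intros H; [lra|].
  apply Rplus_le_compat; auto.
Qed.

Lemma lsumR_pos {I} (b : I -> R) (l : list I) :
  (forall i, (0 <= b i)%R) -> (0 <= lsumR b l)%R.
Proof.
  intros H; induction l as [|a l IH]; simpl; [lra|]; specialize (H a); lra.
Qed.

Lemma Cmod_lsum {I} (f : I -> C) (l : list I) :
  (Cmod (lsum f l) <= lsumR (fun i => Cmod (f i)) l)%R.
Proof.
  induction l as [|a l IH]; simpl; [rewrite Cmod_0; lra|].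
  eapply Rle_trans; [apply Cmod_triangle|lra].
Qed.

Lemma re_lsum {I} (f : I -> C) (l : list I) :
  Re (lsum f l) = lsumR (fun i => Re (f i)) l.
Proof. induction l as [|a l IH]; simpl in *; [easy|rewrite <- IH; easy]. Qed.

Lemma im_lsum {I} (f : I -> C) (l : list I) :
  Im (lsum f l) = lsumR (fun i => Im (f i)) l.
Proof. induction l as [|a l IH]; simpl in *; [easy|rewrite <- IH; easy]. Qed.

Lemma nodup_exists {I} (L : list I) :
  exists l, NoDup l /\ forall i, In i l <-> In i L.
Proof.
  induction L as [|a L [l [h H]]]; [exists nil; split; [constructor|easy]|].
  destruct (classic (In a l)) as [ha|ha].
  - exists l; split; [exact h|]; intros i; simpl; rewrite <- H.
    intuition; subst; auto.
  - exists (a :: l); split; [constructor; assumption|].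
    intros i; simpl; rewrite H; easy.
Qed.

Lemma nodup_incl_split {I} (L l : list I) :
  NoDup L -> NoDup l -> incl L l -> exists R, Permutation l (L ++ R).
Proof.
  revert l; induction L as [|a L IH]; intros l HL Hl Hi; [exists l; apply Permutation_refl|].
  inversion HL; subst.
  destruct (in_split a l) as [l1 [l2 ->]]; [apply Hi; left; easy|].
  destruct (IH (l1 ++ l2)) as [R HR]; [assumption|eapply NoDup_remove_1; eauto| |].
  - intros x hx; assert (x <> a) by congruence.
    specialize (Hi x (or_intror hx)); apply in_app_or in Hi; apply in_or_app.
    simpl in Hi; intuition congruence.
  - exists R; simpl; transitivity (a :: l1 ++ l2);
      [symmetry; apply Permutation_middle|constructor; exact HR].
Qed.

Lemma lsumR_incl {I} (b : I -> R) (L l : list I) :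
  (forall i, (0 <= b i)%R) -> NoDup L -> NoDup l -> incl L l ->
  (lsumR b L <= lsumR b l)%R.
Proof.
  intros hb HL Hl Hi; destruct (nodup_incl_split _ _ HL Hl Hi) as [R HR].
  rewrite (lsumR_perm _ _ _ HR), lsumR_app.
  pose proof (lsumR_pos b R hb); lra.
Qed.

Lemma NoDup_map_inj {I J} (e : I -> J) (l : list I) :
  (forall i j, e i = e j -> i = j) -> NoDup l -> NoDup (map e l).
Proof.
  intros he; induction 1 as [|a l h H IH]; simpl; constructor; [|exact IH].
  intros hin; apply in_map_iff in hin as [i [hi hin]].
  apply he in hi; subst; contradiction.
Qed.

Lemma lsumR_nonneg_limit {I} (b : I -> R) (M : R) :
  (forall i, (0 <= b i)%R) -> (forall l, NoDup l -> (lsumR b l <= M)%R) ->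
  exists s, forall eps, (0 < eps)%R ->
    exists L, forall l, NoDup l -> incl L l -> (Rabs (lsumR b l - s) < eps)%R.
Proof.
  intros hb HM.
  destruct (completeness (fun x => exists l, NoDup l /\ x = lsumR b l)) as [s [Hs1 Hs2]].
  - exists M; intros x [l [h ->]]; auto.
  - exists 0%R, nil; split; [constructor|easy].
  - exists s; intros e he.
    assert (exists L, NoDup L /\ (s - e < lsumR b L)%R) as [L [HL h]].
    { apply NNPP; intros hn; enough (s <= s - e)%R by lra.
      apply Hs2; intros x [l [hl ->]]; apply Rnot_lt_le; intros h; apply hn; eauto. }
    exists L; intros l hl hi.
    pose proof (lsumR_incl b L l hb HL hl hi).
    assert (lsumR b l <= s)%R by (apply Hs1; eauto).
    apply Rabs_def1; lra.
Qed.

(** Real and imaginary parts are differences of nonnegative families with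
    bounded finite sums, and for these the supremum of the finite sums is the
    limit. *)
Lemma summable_has_sum {I} (f : I -> C) : summable f -> has_sum f (tsum f).
Proof.
  intros Hf; unfold tsum; apply epsilon_spec; destruct Hf as [M HM].
  assert (forall r : C -> R, (forall z, (Rabs (r z) <= Cmod z)%R) ->
    exists s, forall eps, (0 < eps)%R -> exists L, forall l, NoDup l -> incl L l ->
      (Rabs (lsumR (fun i => r (f i)) l - s) < eps)%R) as K.
  { (* the real family [r (f i)] is a difference of two nonnegative ones *)
    intros r hr.
    destruct (lsumR_nonneg_limit (fun i => Cmod (f i)) M) as [s1 H1];
      [intros; apply Cmod_ge_0|exact HM|].
    destruct (lsumR_nonneg_limit (fun i => (Cmod (f i) + r (f i))%R) (2 * M)) as [s2 H2].
    - intros i; specialize (hr (f i)); apply Rabs_le_between in hr; lra.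
    - intros l hl; specialize (HM l hl).
      apply Rle_trans with (lsumR (fun i => 2 * Cmod (f i))%R l); [|rewrite lsumR_scal; lra].
      apply lsumR_le; intros i _; specialize (hr (f i)); apply Rabs_le_between in hr; lra.
    - exists (s2 - s1)%R; intros e he.
      destruct (H1 (e / 2)%R) as [L1 h1]; [lra|]; destruct (H2 (e / 2)%R) as [L2 h2]; [lra|].
      exists (L1 ++ L2); intros l hl hi.
      specialize (h1 l hl (fun x hx => hi x (in_or_app _ _ _ (or_introl hx)))).
      specialize (h2 l hl (fun x hx => hi x (in_or_app _ _ _ (or_intror hx)))).
      rewrite lsumR_plus in h2.
      apply Rabs_def2 in h1; apply Rabs_def2 in h2; apply Rabs_def1; lra. }
  destruct (K Re re_le_Cmod) as [x Hx].
  assert (forall z, (Rabs (Im z) <= Cmod z)%R) as him.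
  { intros z; eapply Rle_trans; [apply Rmax_r|apply (Rmax_Cmod z)]. }
  destruct (K Im him) as [y Hy].
  exists (x, y); split; [exists M; exact HM|]; intros e he.
  destruct (Hx (e / 2)%R) as [L1 h1]; [lra|]; destruct (Hy (e / 2)%R) as [L2 h2]; [lra|].
  exists (L1 ++ L2); intros l hl hi.
  specialize (h1 l hl (fun x hx => hi x (in_or_app _ _ _ (or_introl hx)))).
  specialize (h2 l hl (fun x hx => hi x (in_or_app _ _ _ (or_intror hx)))).
  eapply Rle_lt_trans; [apply Cmod_le_sum|].
  rewrite <- re_lsum in h1; rewrite <- im_lsum in h2.
  unfold Rminus in h1, h2.
  replace (Re (lsum f l - (x, y))) with (Re (lsum f l) + - x)%R by (destruct (lsum f l); simpl; ring).
  replace (Im (lsum f l - (x, y))) with (Im (lsum f l) + - y)%R by (destruct (lsum f l); simpl; ring).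
  lra.
Qed.

Lemma has_sum_unique {I} (f : I -> C) (s t : C) : has_sum f s -> has_sum f t -> s = t.
Proof.
  intros [_ H] [_ H']; apply Ceq_of_dist_lt; intros e he.
  destruct (H (e / 2)%R) as [L1 h1]; [lra|]; destruct (H' (e / 2)%R) as [L2 h2]; [lra|].
  destruct (nodup_exists (L1 ++ L2)) as [l [hl hi]].
  specialize (h1 l hl (fun x hx => proj2 (hi x) (in_or_app _ _ _ (or_introl hx)))).
  specialize (h2 l hl (fun x hx => proj2 (hi x) (in_or_app _ _ _ (or_intror hx)))).
  pose proof (Cmod_triangle_sub s (lsum f l) t) as T.
  rewrite (Cmod_sub_sym s (lsum f l)) in T; lra.
Qed.

Lemma has_sum_tsum {I} (f : I -> C) (s : C) : has_sum f s -> tsum f = s.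
Proof.
  intros H; apply has_sum_unique with f; [apply summable_has_sum, (proj1 H)|exact H].
Qed.

Lemma summable_le {I} (f g : I -> C) :
  summable g -> (forall i, (Cmod (f i) <= Cmod (g i))%R) -> summable f.
Proof.
  intros [M HM] H; exists M; intros l hl; eapply Rle_trans; [|apply (HM l hl)].
  apply lsumR_le; auto.
Qed.

Lemma summable_scal {I} (c : C) (f : I -> C) : summable f -> summable (fun i => c * f i).
Proof.
  intros [M HM]; exists (Cmod c * M)%R; intros l hl.
  apply Rle_trans with (lsumR (fun i => Cmod c * Cmod (f i))%R l).
  - apply lsumR_le; intros; rewrite Cmod_mult; lra.
  - rewrite lsumR_scal; apply Rmult_le_compat_l; [apply Cmod_ge_0|auto].
Qed.

Lemma summable_plus {I} (f g : I -> C) :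
  summable f -> summable g -> summable (fun i => f i + g i).
Proof.
  intros [M HM] [M' HM']; exists (M + M')%R; intros l hl.
  apply Rle_trans with (lsumR (fun i => Cmod (f i) + Cmod (g i))%R l).
  - apply lsumR_le; intros; apply Cmod_triangle.
  - rewrite lsumR_plus; specialize (HM l hl); specialize (HM' l hl); lra.
Qed.

Lemma summable_inj {I J} (e : I -> J) (f : J -> C) :
  (forall i j, e i = e j -> i = j) -> summable f -> summable (fun i => f (e i)).
Proof.
  intros he [M HM]; exists M; intros l hl.
  rewrite <- (lsumR_map e (fun j => Cmod (f j))).
  apply HM, NoDup_map_inj; assumption.
Qed.

Lemma has_sum_ext {I} (f g : I -> C) (s : C) :
  (forall i, f i = g i) -> has_sum f s -> has_sum g s.
Proof.
  intros H [[M HM] Hs]; split.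
  - apply summable_le with f; [exists M; exact HM|]; intros i; rewrite H; lra.
  - intros e he; destruct (Hs e he) as [L h]; exists L; intros l hl hi.
    rewrite <- (lsum_ext_in f g); auto.
Qed.

Lemma has_sum_scal {I} (c : C) (f : I -> C) (s : C) :
  has_sum f s -> has_sum (fun i => c * f i) (c * s).
Proof.
  intros [Hf Hs]; split; [apply summable_scal, Hf|]; intros e he.
  pose proof (Cmod_ge_0 c) as hc.
  destruct (Hs (e / (Cmod c + 1))%R) as [L h]; [apply Rdiv_lt_0_compat; lra|].
  exists L; intros l hl hi; specialize (h l hl hi); rewrite lsum_scal.
  replace (c * lsum f l - c * s) with (c * (lsum f l - s)) by ring; rewrite Cmod_mult.
  pose proof (Cmod_ge_0 (lsum f l - s)).
  apply Rle_lt_trans with ((Cmod c + 1) * Cmod (lsum f l - s))%R;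
    [apply Rmult_le_compat_r; lra|].
  replace e with ((Cmod c + 1) * (e / (Cmod c + 1)))%R by (field; lra).
  apply Rmult_lt_compat_l; lra.
Qed.

Lemma has_sum_plus {I} (f g : I -> C) (s t : C) :
  has_sum f s -> has_sum g t -> has_sum (fun i => f i + g i) (s + t).
Proof.
  intros [Hf Hs] [Hg Ht]; split; [apply summable_plus; assumption|]; intros e he.
  destruct (Hs (e / 2)%R) as [L1 h1]; [lra|]; destruct (Ht (e / 2)%R) as [L2 h2]; [lra|].
  exists (L1 ++ L2); intros l hl hi.
  specialize (h1 l hl (fun x hx => hi x (in_or_app _ _ _ (or_introl hx)))).
  specialize (h2 l hl (fun x hx => hi x (in_or_app _ _ _ (or_intror hx)))).
  rewrite lsum_plus.
  replace (lsum f l + lsum g l - (s + t)) with ((lsum f l - s) + (lsum g l - t)) by ring.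
  eapply Rle_lt_trans; [apply Cmod_triangle|lra].
Qed.

Lemma has_sum_lsum {I J} (f : J -> I -> C) (s : J -> C) (l : list J) :
  (forall j, In j l -> has_sum (f j) (s j)) ->
  has_sum (fun i => lsum (fun j => f j i) l) (lsum s l).
Proof.
  induction l as [|a l IH]; simpl; intros H.
  - split.
    + exists 0%R; intros l _; simpl; rewrite Cmod_0; induction l; simpl; lra.
    + intros e he; exists nil; intros l _ _; rewrite lsum_0_in by easy.
      replace (0 - 0) with (RtoC 0) by ring; rewrite Cmod_0; exact he.
  - apply has_sum_plus; auto.
Qed.

(** Reindexing along an injection whose range contains the support: this
    covers changes of variables as well as the extraction of a residue class
    or of a half-line from a sum over the integers. *)
Lemma has_sum_inj {I J} (e : I -> J) (f : J -> C) (s : C) :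
  (forall i j, e i = e j -> i = j) ->
  (forall j, (exists i, e i = j) \/ f j = 0) ->
  has_sum f s -> has_sum (fun i => f (e i)) s.
Proof.
  intros he hs [Hf Hs]; split; [apply summable_inj; assumption|]; intros eps hp.
  destruct (Hs eps hp) as [L h].
  assert (exists L0, forall i, In (e i) L -> In i L0) as [L0 HL0].
  { clear h; induction L as [|j L [L0 IH]]; [exists nil; easy|].
    destruct (classic (exists i, e i = j)) as [[i hi]|hn].
    - exists (i :: L0); intros k [hk|hk]; [left|right; auto].
      apply he; congruence.
    - exists L0; intros k [hk|hk]; [exfalso; eauto|auto]. }
  exists L0; intros l hl hi.
  destruct (nodup_exists (map e l ++ L)) as [X [hX hXi]].
  assert (incl (map e l) X) as hinc by (intros x hx; apply hXi, in_or_app; auto).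
  destruct (nodup_incl_split (map e l) X) as [R HR];
    [apply NoDup_map_inj; assumption|assumption|assumption|].
  replace (lsum (fun i => f (e i)) l) with (lsum f X).
  - apply h; [exact hX|intros x hx; apply hXi, in_or_app; auto].
  - rewrite (lsum_perm _ _ _ HR), lsum_app, lsum_map.
    rewrite (lsum_0_in f R); [ring|]; intros j hj.
    destruct (hs j) as [[i <-]|]; [exfalso|assumption].
    assert (In (e i) X) as hx
      by (apply (Permutation_in _ (Permutation_sym HR)), in_or_app; auto).
    assert (NoDup (map e l ++ R)) as hnd by (eapply Permutation_NoDup; eauto).
    assert (~ In (e i) (map e l)) as hni.
    { intros hin; apply in_split in hj as [R1 [R2 ->]].
      apply in_split in hin as [l1 [l2 hl12]]; rewrite hl12 in hnd.
      rewrite <- app_assoc in hnd; simpl in hnd.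
      apply NoDup_remove_2 in hnd; apply hnd.
      apply in_or_app; right; apply in_or_app; right; apply in_or_app; right; left; easy. }
    apply hXi, in_app_or in hx as [hx|hx]; [contradiction|].
    apply hni, in_map, hi, HL0, hx.
Qed.

(** The Cauchy criterion: what is left outside a large finite set is small. *)
Lemma summable_tail {I} (f : I -> C) (eps : R) :
  summable f -> (0 < eps)%R ->
  exists L, NoDup L /\ forall R, NoDup R -> (forall i, In i R -> ~ In i L) ->
    (lsumR (fun i => Cmod (f i)) R < eps)%R.
Proof.
  intros [M HM] he.
  destruct (lsumR_nonneg_limit (fun i => Cmod (f i)) M) as [s H];
    [intros; apply Cmod_ge_0|exact HM|].
  destruct (H (eps / 2)%R) as [L0 h]; [lra|].
  destruct (nodup_exists L0) as [L [hL hi]].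
  exists L; split; [exact hL|]; intros R hR hd.
  pose proof (h L hL (fun x hx => proj2 (hi x) hx)) as h1.
  assert (NoDup (L ++ R)) as hLR.
  { apply NoDup_app; try assumption; intros x hx hx'; exact (hd x hx' hx). }
  pose proof (h (L ++ R) hLR
    (fun x hx => in_or_app _ _ _ (or_introl (proj2 (hi x) hx)))) as h2.
  rewrite lsumR_app in h2.
  apply Rabs_def2 in h1; apply Rabs_def2 in h2; lra.
Qed.

Lemma has_sum_tail {I} (f : I -> C) (s : C) (eps : R) (L : list I) :
  has_sum f s -> NoDup L ->
  (forall R, NoDup R -> (forall i, In i R -> ~ In i L) ->
    (lsumR (fun i => Cmod (f i)) R <= eps)%R) ->
  (Cmod (lsum f L - s) <= eps)%R.
Proof.
  intros [_ H] hL ht; apply Rnot_lt_le; intros hlt.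
  destruct (H (Cmod (lsum f L - s) - eps)%R) as [L' h]; [lra|].
  destruct (nodup_exists (L ++ L')) as [X [hX hXi]].
  destruct (nodup_incl_split L X hL hX) as [R HR];
    [intros x hx; apply hXi, in_or_app; auto|].
  specialize (h X hX (fun x hx => proj2 (hXi x) (in_or_app _ _ _ (or_intror hx)))).
  assert (NoDup (L ++ R)) as hLR by (eapply Permutation_NoDup; eauto).
  assert (lsumR (fun i => Cmod (f i)) R <= eps)%R as hR.
  { apply ht; [eapply NoDup_app_remove_l; eauto|].
    intros i hi hiL; apply in_split in hiL as [l1 [l2 ->]].
    rewrite <- app_assoc in hLR; simpl in hLR.
    apply NoDup_remove_2 in hLR; apply hLR, in_or_app; right; apply in_or_app; auto. }
  rewrite (lsum_perm _ _ _ HR), lsum_app in h.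
  pose proof (Cmod_lsum f R).
  pose proof (Cmod_triangle (lsum f L + lsum f R - s) (- lsum f R)) as T.
  replace (lsum f L + lsum f R - s + - lsum f R) with (lsum f L - s) in T by ring.
  rewrite Cmod_opp in T; lra.
Qed.

Lemma Clim_lsum {I} (f : nat -> I -> C) (g : I -> C) (L : list I) :
  (forall i, Clim (fun n => f n i) (g i)) -> Clim (fun n => lsum (f n) L) (lsum g L).
Proof.
  intros H; induction L as [|a L IH]; simpl; [apply Clim_const|].
  apply Clim_plus; auto.
Qed.

(** Dominated convergence: outside a finite set all terms are controlled by the
    tail of the majorant, and on the finite set the convergence is uniform. *)
Lemma Tannery {I} (f : nat -> I -> C) (g : I -> C) (b : I -> C) (s : nat -> C) (t : C) :
  summable b ->
  (forall n i, (Cmod (f n i) <= Cmod (b i))%R) ->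
  (forall i, Clim (fun n => f n i) (g i)) ->
  (forall n, has_sum (f n) (s n)) -> has_sum g t -> Clim s t.
Proof.
  intros Hb Hd Hl Hs Ht e he.
  destruct (summable_tail b (e / 4)%R Hb) as [L [hL h]]; [lra|].
  destruct (Clim_lsum f g L Hl (e / 4)%R) as [N HN]; [lra|].
  exists N; intros n hn; specialize (HN n hn).
  assert (forall u : I -> C, (forall i, (Cmod (u i) <= Cmod (b i))%R) ->
    forall r, has_sum u r -> (Cmod (lsum u L - r) <= e / 4)%R) as K.
  { intros u hu r hr; apply has_sum_tail; [assumption|assumption|].
    intros R hR hdis; left; eapply Rle_lt_trans; [|apply (h R hR hdis)].
    apply lsumR_le; auto. }
  pose proof (K (f n) (Hd n) _ (Hs n)) as h1.
  pose proof (K g (fun i => Clim_le _ _ _ (Hl i) (fun n => Hd n i)) _ Ht) as h2.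
  pose proof (Cmod_triangle_sub (s n) (lsum (f n) L) t) as T1.
  pose proof (Cmod_triangle_sub (lsum (f n) L) (lsum g L) t) as T2.
  rewrite (Cmod_sub_sym (s n) (lsum _ _)) in T1; lra.
Qed.

Lemma lsum_list_prod {I J} (f : I -> C) (g : J -> C) (l : list I) (m : list J) :
  lsum (fun p => f (fst p) * g (snd p)) (list_prod l m) = lsum f l * lsum g m.
Proof.
  induction l as [|a l IH]; simpl; [ring|].
  rewrite lsum_app, lsum_map, IH; simpl; rewrite lsum_scal; ring.
Qed.

Lemma lsumR_list_prod {I J} (f : I -> R) (g : J -> R) (l : list I) (m : list J) :
  lsumR (fun p => f (fst p) * g (snd p))%R (list_prod l m) = (lsumR f l * lsumR g m)%R.
Proof.
  induction l as [|a l IH]; simpl; [ring|].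
  rewrite lsumR_app, lsumR_map, IH; simpl; rewrite lsumR_scal; ring.
Qed.

Lemma NoDup_list_prod {I J} (l : list I) (m : list J) :
  NoDup l -> NoDup m -> NoDup (list_prod l m).
Proof.
  intros hl hm; induction hl as [|a l h H IH]; simpl; [constructor|].
  apply NoDup_app; [|exact IH|].
  - apply NoDup_map_inj; [congruence|exact hm].
  - intros [i j] hi hj; apply in_map_iff in hi as [k [hk _]]; injection hk as -> _.
    apply in_prod_iff in hj as [hj _]; contradiction.
Qed.

Lemma list_prod_cover {I J} (l : list (I * J)) :
  exists l1 l2, NoDup l1 /\ NoDup l2 /\
    (forall i, In i l1 <-> In i (map fst l)) /\ (forall j, In j l2 <-> In j (map snd l)) /\
    incl l (list_prod l1 l2).
Proof.
  destruct (nodup_exists (map fst l)) as [l1 [h1 h1']].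
  destruct (nodup_exists (map snd l)) as [l2 [h2 h2']].
  exists l1, l2; repeat (split; try assumption).
  intros [i j] hij; apply in_prod; [apply h1'|apply h2'].
  - apply (in_map fst _ _ hij).
  - apply (in_map snd _ _ hij).
Qed.

Lemma summable_prod {I J} (f : I -> C) (g : J -> C) :
  summable f -> summable g -> summable (fun p => f (fst p) * g (snd p)).
Proof.
  intros [M HM] [M' HM']; exists (M * M')%R; intros l hl.
  destruct (list_prod_cover l) as [l1 [l2 [h1 [h2 [_ [_ hi]]]]]].
  apply Rle_trans with (lsumR (fun p => Cmod (f (fst p) * g (snd p))) (list_prod l1 l2)).
  - apply lsumR_incl; try assumption; [intros; apply Cmod_ge_0|].
    apply NoDup_list_prod; assumption.
  - apply Rle_trans with
      (lsumR (fun p => Cmod (f (fst p)) * Cmod (g (snd p)))%R (list_prod l1 l2)).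
    + apply lsumR_le; intros; rewrite Cmod_mult; lra.
    + rewrite (lsumR_list_prod (fun i => Cmod (f i)) (fun j => Cmod (g j))).
      apply Rmult_le_compat; auto; apply lsumR_pos; intros; apply Cmod_ge_0.
Qed.

(** The partial sums over a rectangle factor, and every finite set of pairs is
    contained in a rectangle. *)
Lemma has_sum_prod {I J} (f : I -> C) (g : J -> C) (s t : C) :
  has_sum f s -> has_sum g t -> has_sum (fun p => f (fst p) * g (snd p)) (s * t).
Proof.
  intros [Hf Hs] [Hg Ht].
  pose proof (summable_has_sum _ (summable_prod f g Hf Hg)) as H.
  replace (s * t) with (tsum (fun p => f (fst p) * g (snd p))); [exact H|].
  destruct H as [_ H]; set (u := tsum _) in *.
  (* all three sums are approximated along one and the same finite rectangle *)
  assert (forall n : nat, exists x y : C, (Cmod (x - s) < / (INR n + 1))%R /\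
     (Cmod (y - t) < / (INR n + 1))%R /\ (Cmod (x * y - u) < / (INR n + 1))%R) as K.
  { intros n; pose proof (pos_INR n).
    assert (0 < / (INR n + 1))%R as hp by (apply Rinv_0_lt_compat; lra).
    destruct (Hs _ hp) as [L1 h1]; destruct (Ht _ hp) as [L2 h2].
    destruct (H _ hp) as [L h].
    destruct (nodup_exists (L1 ++ map fst L)) as [l1 [n1 i1]].
    destruct (nodup_exists (L2 ++ map snd L)) as [l2 [n2 i2]].
    exists (lsum f l1), (lsum g l2); split; [|split].
    - apply h1; [exact n1|intros x hx; apply i1, in_or_app; auto].
    - apply h2; [exact n2|intros x hx; apply i2, in_or_app; auto].
    - rewrite <- lsum_list_prod; apply h; [apply NoDup_list_prod; assumption|].
      intros [i j] hij; apply in_prod; [apply i1|apply i2]; apply in_or_app; right.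
      + apply (in_map fst _ _ hij).
      + apply (in_map snd _ _ hij). }
  apply choice in K as [x K]; apply choice in K as [y K].
  assert (forall (v : nat -> C) (r : C),
    (forall n, (Cmod (v n - r) < / (INR n + 1))%R) -> Clim v r) as lim.
  { intros v r hv e he; destruct (archimed_cor1 e he) as [N [hN hN0]].
    exists N; intros n hn; eapply Rlt_trans; [apply hv|].
    eapply Rle_lt_trans; [|exact hN].
    apply Rinv_le_contravar; [apply lt_0_INR; lia|].
    apply le_INR in hn; lra. }
  apply Clim_unique with (fun n => x n * y n).
  - apply lim; intros n; apply K.
  - apply Clim_mult; apply lim; intros n; apply K.
Qed.

Lemma has_sum_finite {I} (f : I -> C) (L : list I) :
  NoDup L -> (forall i, ~ In i L -> f i = 0) -> has_sum f (lsum f L).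
Proof.
  intros hL h0; split.
  - exists (lsumR (fun i => Cmod (f i)) L); intros l hl.
    destruct (nodup_exists (L ++ l)) as [X [hX hi]].
    apply Rle_trans with (lsumR (fun i => Cmod (f i)) X).
    + apply lsumR_incl; try assumption; [intros; apply Cmod_ge_0|].
      intros x hx; apply hi, in_or_app; auto.
    + destruct (nodup_incl_split L X hL hX) as [R HR];
        [intros x hx; apply hi, in_or_app; auto|].
      rewrite (lsumR_perm _ _ _ HR), lsumR_app.
      enough (lsumR (fun i => Cmod (f i)) R = 0)%R by lra.
      assert (NoDup (L ++ R)) as hLR by (eapply Permutation_NoDup; eauto).
      assert (forall i, In i R -> ~ In i L) as hd.
      { intros i hiR hiL; apply in_split in hiL as [l1 [l2 ->]].
        rewrite <- app_assoc in hLR; simpl in hLR.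
        apply NoDup_remove_2 in hLR; apply hLR, in_or_app; right; apply in_or_app; auto. }
      clear HR hLR; induction R as [|a R IH]; simpl; [easy|].
      rewrite IH; [|intros i hh; apply hd; right; exact hh].
      rewrite h0; [rewrite Cmod_0; ring|apply hd; left; easy].
  - intros e he; exists L; intros l hl hi.
    destruct (nodup_incl_split L l hL hl hi) as [R HR].
    rewrite (lsum_perm _ _ _ HR), lsum_app, (lsum_0_in f R).
    + replace (lsum f L + 0 - lsum f L) with (RtoC 0) by ring; rewrite Cmod_0; exact he.
    + assert (NoDup (L ++ R)) as hLR by (eapply Permutation_NoDup; eauto).
      intros i hiR; apply h0; intros hiL; apply in_split in hiL as [l1 [l2 ->]].
      rewrite <- app_assoc in hLR; simpl in hLR.
      apply NoDup_remove_2 in hLR; apply hLR, in_or_app; right; apply in_or_app; auto.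
Qed.

Lemma sum_n_lsum (f : nat -> C) (n : nat) : sum_n f n = lsum f (seq 0 (S n)).
Proof.
  induction n as [|n IH]; [rewrite sum_O; simpl; ring|].
  rewrite sum_Sn, IH, (seq_S (S n) 0), lsum_app; simpl.
  unfold plus; simpl; ring.
Qed.

Lemma list_nat_bounded (L : list nat) : exists N, forall i, In i L -> (i < N)%nat.
Proof.
  induction L as [|a L [N IH]]; [exists 0%nat; easy|].
  exists (max (S a) N); intros i [<-|hi]; [lia|specialize (IH i hi); lia].
Qed.

Lemma has_sum_nat_Clim (f : nat -> C) (s : C) : has_sum f s -> Clim (sum_n f) s.
Proof.
  intros [_ H] e he; destruct (H e he) as [L h].
  destruct (list_nat_bounded L) as [N HN]; exists N; intros n hn.
  rewrite sum_n_lsum; apply h; [apply seq_NoDup|].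
  intros i hi; apply in_seq; specialize (HN i hi); lia.
Qed.

Lemma lsumR_Z_le (b : Z -> R) (M M' : R) :
  (forall l : list nat, NoDup l -> (lsumR (fun n => b (Z.of_nat n)) l <= M)%R) ->
  (forall l : list nat, NoDup l -> (lsumR (fun n => b (- Z.of_nat n)%Z) l <= M')%R) ->
  forall l, NoDup l -> (lsumR b l <= M + M')%R.
Proof.
  intros HM HM' l hl.
  (* the absolute values send a duplicate-free list of integers of one sign to
     a duplicate-free list of naturals *)
  assert (forall (sg : Z -> bool) (e : nat -> Z) B,
    (forall z, sg z = true -> e (Z.abs_nat z) = z) ->
    (forall m, NoDup m -> (lsumR (fun n => b (e n)) m <= B)%R) ->
    (lsumR b (filter sg l) <= B)%R) as K.
  { intros sg e B he hB.
    assert (forall m, (forall z, In z m -> sg z = true) -> NoDup m ->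
      map e (map Z.abs_nat m) = m /\ NoDup (map Z.abs_nat m)) as A.
    { induction m as [|a m IH]; intros hm hn; simpl; [split; [easy|constructor]|].
      inversion hn; subst; destruct IH as [IH1 IH2];
        [intros; apply hm; right; assumption|assumption|].
      rewrite he, IH1 by (apply hm; left; easy); split; [easy|constructor; [|exact IH2]].
      intros hin; apply (in_map e) in hin; rewrite IH1, he in hin by (apply hm; left; easy).
      contradiction. }
    destruct (A (filter sg l)) as [A1 A2];
      [intros z hz; apply filter_In in hz; apply hz|apply NoDup_filter, hl|].
    rewrite <- A1, lsumR_map; apply hB, A2. }
  assert (lsumR b l =
    lsumR b (filter (fun z => (0 <=? z)%Z) l) +
    lsumR b (filter (fun z => (z <? 0)%Z) l))%R as ->.
  { clear; induction l as [|a l IH]; simpl; [ring|]; rewrite IH.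
    destruct (Z.leb_spec 0 a), (Z.ltb_spec a 0); simpl; try lia; ring. }
  apply Rplus_le_compat.
  - apply (K _ Z.of_nat); [intros z hz; apply Z.leb_le in hz; lia|exact HM].
  - apply (K _ (fun n => (- Z.of_nat n)%Z)); [intros z hz; apply Z.ltb_lt in hz; lia|exact HM'].
Qed.

Lemma summable_Z (f : Z -> C) :
  summable (fun n : nat => f (Z.of_nat n)) ->
  summable (fun n : nat => f (- Z.of_nat n)%Z) -> summable f.
Proof.
  intros [M HM] [M' HM']; exists (M + M')%R.
  apply (lsumR_Z_le (fun z => Cmod (f z))); assumption.
Qed.

Lemma lsumR_nat_le (b : nat -> R) (M : R) :
  (forall n, (0 <= b n)%R) -> (forall n, (lsumR b (seq 0 n) <= M)%R) ->
  forall l, NoDup l -> (lsumR b l <= M)%R.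
Proof.
  intros hb H l hl; destruct (list_nat_bounded l) as [N HN].
  eapply Rle_trans; [|apply (H N)].
  apply lsumR_incl; [exact hb|exact hl|apply seq_NoDup|].
  intros i hi; apply in_seq; specialize (HN i hi); lia.
Qed.

Lemma summable_nat (f : nat -> C) (M : R) :
  (forall n, (lsumR (fun i => Cmod (f i)) (seq 0 n) <= M)%R) -> summable f.
Proof.
  intros H; exists M; apply lsumR_nat_le; [intros; apply Cmod_ge_0|exact H].
Qed.

Lemma has_sum_Cmod_le {I} (f : I -> C) (s : C) (M : R) :
  has_sum f s -> (forall l, NoDup l -> (lsumR (fun i => Cmod (f i)) l <= M)%R) ->
  (Cmod s <= M)%R.
Proof.
  intros Hs HM; pose proof (has_sum_tail f s M nil Hs (NoDup_nil _)
    (fun R hR _ => HM R hR)) as h; simpl in h.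
  replace (0 - s) with (- s) in h by ring; rewrite Cmod_opp in h; exact h.
Qed.

Lemma lsumR_geom (r : R) (n : nat) :
  (0 <= r < 1)%R -> (lsumR (fun i => r ^ i)%R (seq 0 n) <= / (1 - r))%R.
Proof.
  intros hr.
  assert (lsumR (fun i => r ^ i)%R (seq 0 n) = (1 - r ^ n) / (1 - r))%R as ->.
  { induction n as [|n IH]; [simpl; field; lra|].
    rewrite seq_S, lsumR_app, IH; simpl; field; lra. }
  unfold Rdiv; rewrite <- (Rmult_1_l (/ (1 - r))) at 2.
  apply Rmult_le_compat_r; [left; apply Rinv_0_lt_compat; lra|].
  pose proof (pow_le r n (proj1 hr)); lra.
Qed.

(** * Exponentials and Gaussian families *)

Definition E (x : C) : C := Cexp (PI * Ci * x).

Lemma Cexp_plus (x y : C) : Cexp (x + y) = Cexp x * Cexp y.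
Proof.
  unfold Cexp, Cmult; destruct x as [a b], y as [c d]; simpl.
  rewrite exp_plus, cos_plus, sin_plus; f_equal; ring.
Qed.

Lemma Cmod_Cexp (z : C) : Cmod (Cexp z) = exp (Re z).
Proof.
  unfold Cmod, Cexp; simpl.
  replace (_ + _)%R with ((exp (Re z))²)%R.
  - apply sqrt_Rsqr; left; apply exp_pos.
  - pose proof (sin2_cos2 (Im z)) as h; unfold Rsqr in *.
    replace (exp (Re z) * exp (Re z))%R
      with (exp (Re z) * exp (Re z) * (sin (Im z) * sin (Im z) + cos (Im z) * cos (Im z)))%R
      by (rewrite h; ring).
    ring.
Qed.

Lemma E_plus (x y : C) : E (x + y) = E x * E y.
Proof. unfold E; rewrite <- Cexp_plus; f_equal; ring. Qed.

Lemma E_0 : E 0 = 1.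
Proof.
  unfold E, Cexp; replace (PI * Ci * 0) with (RtoC 0) by ring.
  simpl; rewrite exp_0, cos_0, sin_0; apply injective_projections; simpl; ring.
Qed.

Lemma Cmod_E (x : C) : Cmod (E x) = exp (- PI * Im x).
Proof.
  unfold E; rewrite Cmod_Cexp; f_equal; destruct x as [a b]; simpl; ring.
Qed.

Lemma E_real (r : R) : E r = (cos (PI * r), sin (PI * r)).
Proof.
  unfold E, Cexp; simpl.
  replace (_ - _)%R with 0%R by ring; rewrite exp_0.
  replace (_ + _)%R with (PI * r)%R by ring; f_equal; ring.
Qed.

Lemma E_1 : E 1 = - (1).
Proof.
  rewrite E_real, Rmult_1_r, cos_PI, sin_PI; apply injective_projections; simpl; ring.
Qed.

Lemma E_neq_0 (x : C) : E x <> 0.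
Proof.
  intros h; pose proof E_0 as h0; replace (RtoC 0) with (x + - x) in h0 at 1 by ring.
  rewrite E_plus, h, Cmult_0_l in h0; apply C1_nz; congruence.
Qed.

Lemma E_opp (x : C) : E (- x) = / E x.
Proof.
  assert (E x * E (- x) = 1) as h
    by (rewrite <- E_plus, <- E_0; f_equal; ring).
  rewrite <- (Cmult_1_l (/ E x)), <- h; field; apply E_neq_0.
Qed.

Lemma E_2Z (n : Z) : E (2 * IZR n) = 1.
Proof.
  assert (forall k : nat, E (2 * INR k) = 1) as K.
  { induction k as [|k IH]; [simpl; rewrite Cmult_0_r; apply E_0|].
    rewrite S_INR, RtoC_plus.
    replace (2 * (INR k + 1)) with (2 * INR k + 1 + 1) by ring.
    rewrite !E_plus, IH, E_1; ring. }
  destruct (Z.le_ge_cases 0 n) as [h|h].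
  - rewrite <- (Z2Nat.id n h), <- INR_IZR_INZ; apply K.
  - replace (2 * IZR n) with (- (2 * INR (Z.to_nat (- n)))).
    + rewrite E_opp, K; field; apply C1_nz.
    + rewrite INR_IZR_INZ, Z2Nat.id, opp_IZR, RtoC_opp by lia; ring.
Qed.

Lemma E_plus_2Z (x : C) (n : Z) : E (x + 2 * IZR n) = E x.
Proof. rewrite E_plus, E_2Z; ring. Qed.

Lemma summable_exp_Z : summable (fun n : Z => RtoC (exp (- Rabs (IZR n)))).
Proof.
  assert (exp (-1) < 1)%R as h.
  { rewrite <- exp_0; apply exp_increasing; lra. }
  pose proof (exp_pos (-1)) as h0.
  assert (summable (fun n : nat => RtoC (exp (- INR n)))) as K.
  { apply summable_nat with (/ (1 - exp (-1)))%R; intros n.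
    eapply Rle_trans; [|apply (lsumR_geom (exp (-1)) n); lra].
    apply lsumR_le; intros i _; rewrite Cmod_R, Rabs_pos_eq by (left; apply exp_pos).
    apply Req_le; induction i as [|i IH]; [simpl; rewrite Ropp_0; apply exp_0|].
    rewrite S_INR, Ropp_plus_distr, exp_plus, IH; replace (- (1))%R with (-1)%R by lra; simpl; ring. }
  apply summable_Z; (eapply summable_le; [exact K|]); intros n; simpl;
    [|rewrite opp_IZR, Rabs_Ropp];
    rewrite <- INR_IZR_INZ, (Rabs_pos_eq (INR n)) by apply pos_INR; lra.
Qed.

Lemma Im_le_Cmod (z : C) : (Rabs (Im z) <= Cmod z)%R.
Proof. eapply Rle_trans; [apply Rmax_r|apply (Rmax_Cmod z)]. Qed.

Lemma exp_le (x y : R) : (x <= y)%R -> (exp x <= exp y)%R.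
Proof. intros [h|h]; [left; apply exp_increasing, h|right; rewrite h; easy]. Qed.

(** The quadratic term wins over any linear one, locally uniformly in the
    translation [w]. *)
Lemma gauss_bound (t : C) (W K : R) :
  (0 < Im t)%R -> (0 <= W)%R -> (0 <= K)%R ->
  exists M, (0 < M)%R /\ forall (x : R) (w : C), (Cmod w <= W)%R ->
    (Cmod (E (t * (x + w) ^ 2)) <= M * exp (- K * Rabs x))%R.
Proof.
  intros ht hW hK.
  set (b := (2 * PI * (Cmod t * W) + K)%R); set (a := (PI * Im t)%R).
  pose proof PI_RGT_0 as hpi; pose proof (Cmod_ge_0 t) as hct.
  assert (0 < a)%R as ha by (apply Rmult_lt_0_compat; assumption).
  exists (exp (b ^ 2 / (4 * a) + PI * (Cmod t * W ^ 2))); split; [apply exp_pos|].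
  intros x w hw; rewrite Cmod_E, <- exp_plus; apply exp_le.
  assert (Im (t * (x + w) ^ 2) = Im t * (x * x) + 2 * x * Im (t * w) + Im (t * (w * w)))%R
    as -> by (destruct t, w; simpl; ring).
  pose proof (Cmod_ge_0 w) as hw0.
  assert (Rabs (Im (t * w)) <= Cmod t * W)%R as h1.
  { eapply Rle_trans; [apply Im_le_Cmod|]; rewrite Cmod_mult.
    apply Rmult_le_compat_l; assumption. }
  assert (Rabs (Im (t * (w * w))) <= Cmod t * W ^ 2)%R as h2.
  { eapply Rle_trans; [apply Im_le_Cmod|]; rewrite !Cmod_mult.
    apply Rmult_le_compat_l; [assumption|]; nra. }
  assert (Rabs (x * Im (t * w)) <= Rabs x * (Cmod t * W))%R as h3.
  { rewrite Rabs_mult; apply Rmult_le_compat_l; [apply Rabs_pos|exact h1]. }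
  apply Rabs_le_between in h2; apply Rabs_le_between in h3.
  set (y := Rabs x) in *.
  assert (x * x = y * y)%R as -> by (unfold y, Rabs; destruct (Rcase_abs x); ring).
  assert (b ^ 2 / (4 * a) - (b * y - a * (y * y)) = a * (y - b / (2 * a)) ^ 2)%R as h4
    by (field; lra).
  assert (0 <= a * (y - b / (2 * a)) ^ 2)%R as h5
    by (apply Rmult_le_pos; [lra|apply pow2_ge_0]).
  assert (PI * - Im (t * (w * w)) <= PI * (Cmod t * W ^ 2))%R as h6
    by (apply Rmult_le_compat_l; lra).
  assert (PI * - (x * Im (t * w)) <= PI * (y * (Cmod t * W)))%R as h7
    by (apply Rmult_le_compat_l; lra).
  unfold a, b in *; nra.
Qed.

Lemma gauss_summable (t w : C) :
  (0 < Im t)%R -> summable (fun n : Z => E (t * (IZR n + w) ^ 2)).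
Proof.
  intros ht; destruct (gauss_bound t (Cmod w) 1 ht (Cmod_ge_0 w)) as [M [hM H]]; [lra|].
  eapply summable_le; [apply (summable_scal (RtoC M) _ summable_exp_Z)|].
  intros n; cbv beta; rewrite Cmod_mult, !Cmod_R, !Rabs_pos_eq by (try (left; apply exp_pos); lra).
  eapply Rle_trans; [apply (H _ _ (Rle_refl _))|].
  apply Req_le; do 2 f_equal; ring.
Qed.

(** * Theta series *)

(** Theta series with characteristic [a], in the variable [z / PI]: the
    characteristics [0] and [1/2] and the shifts of [z] by [0] and [1/2] give
    the four Jacobi theta functions. *)
Definition Theta (a z t : C) : C :=
  tsum (fun n : Z => E (t * (IZR n + a) ^ 2 + 2 * (IZR n + a) * z)).

Lemma Im_pos_neq_0 (t : C) : (0 < Im t)%R -> t <> 0.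
Proof. intros h ->; simpl in h; lra. Qed.

Lemma Theta_has_sum (a z t : C) : (0 < Im t)%R ->
  has_sum (fun n : Z => E (t * (IZR n + a) ^ 2 + 2 * (IZR n + a) * z)) (Theta a z t).
Proof.
  intros ht; apply summable_has_sum.
  destruct (gauss_summable t (a + z / t) ht) as [M HM].
  apply (fun H => summable_le _ (fun n : Z => E (- (z ^ 2 / t)) * E (t * (IZR n + (a + z / t)) ^ 2)) H).
  - apply summable_scal, gauss_summable, ht.
  - intros n; rewrite <- E_plus; apply Req_le; do 2 f_equal; field.
    apply Im_pos_neq_0, ht.
Qed.

Lemma Theta_shift (a z t : C) : (0 < Im t)%R -> Theta (a + 1) z t = Theta a z t.
Proof.
  intros ht; apply has_sum_tsum.
  apply has_sum_ext with
    (fun n : Z => E (t * (IZR (n + 1) + a) ^ 2 + 2 * (IZR (n + 1) + a) * z)).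
  - intros n; rewrite plus_IZR, RtoC_plus; f_equal; ring.
  - apply (has_sum_inj (fun n : Z => (n + 1)%Z)
      (fun n => E (t * (IZR n + a) ^ 2 + 2 * (IZR n + a) * z))).
    + intros i j h; lia.
    + intros j; left; exists (j - 1)%Z; lia.
    + apply Theta_has_sum, ht.
Qed.

Lemma Theta_reflect (a z t : C) : (0 < Im t)%R -> Theta (- a) (- z) t = Theta a z t.
Proof.
  intros ht; apply has_sum_tsum.
  apply has_sum_ext with
    (fun n : Z => E (t * (IZR (- n) + a) ^ 2 + 2 * (IZR (- n) + a) * z)).
  - intros n; rewrite opp_IZR, RtoC_opp; f_equal; ring.
  - apply (has_sum_inj Z.opp
      (fun n => E (t * (IZR n + a) ^ 2 + 2 * (IZR n + a) * z))).
    + intros i j h; lia.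
    + intros j; left; exists (- j)%Z; lia.
    + apply Theta_has_sum, ht.
Qed.

Lemma Theta_period (a z t : C) : (0 < Im t)%R -> Theta a (z + 1) t = E (2 * a) * Theta a z t.
Proof.
  intros ht; apply has_sum_tsum.
  apply has_sum_ext with
    (fun n : Z => E (2 * a) * E (t * (IZR n + a) ^ 2 + 2 * (IZR n + a) * z)).
  - intros n; rewrite <- E_plus, <- (E_plus_2Z _ n); f_equal; ring.
  - apply has_sum_scal, Theta_has_sum, ht.
Qed.

(** [n ^ 2] has the parity of [n], so that [E (n ^ 2) = E n]. *)
Lemma Theta_0_tau_plus_1 (z t : C) : (0 < Im t)%R -> Theta 0 z (t + 1) = Theta 0 (z + 1 / 2) t.
Proof.
  intros ht; symmetry; apply has_sum_tsum.
  apply has_sum_ext with (fun n : Z => E ((t + 1) * (IZR n + 0) ^ 2 + 2 * (IZR n + 0) * z)).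
  - intros n.
    assert (exists k, n * n - n = 2 * k)%Z as [k hk].
    { destruct (Z.Even_or_Odd n) as [[m ->]|[m ->]];
        [exists (2 * m * m - m)%Z|exists (2 * m * m + m)%Z]; lia. }
    rewrite <- (E_plus_2Z (_ + 2 * (IZR n + 0) * (z + 1 / 2)) k); f_equal.
    assert (2 * IZR k = IZR n * IZR n - IZR n) as hC.
    { rewrite <- !RtoC_mult, <- RtoC_minus; f_equal.
      rewrite <- !mult_IZR, <- minus_IZR; f_equal; lia. }
    rewrite hC; field.
  - apply Theta_has_sum; destruct t; simpl in *; lra.
Qed.

(** The sum over the pairs [(m, n)] splits according to the parity of [m - n];
    in the sum and difference of [m] and [n] the quadratic form
    [m ^ 2 + n ^ 2] is diagonal again, with twice the period. *)
Lemma Theta_mul (a b x y t : C) : (0 < Im t)%R ->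
  Theta a x t * Theta b y t =
    Theta ((a + b) / 2) (x + y) (2 * t) * Theta ((a - b) / 2) (x - y) (2 * t)
    + Theta ((a + b + 1) / 2) (x + y) (2 * t) * Theta ((a - b + 1) / 2) (x - y) (2 * t).
Proof.
  intros ht.
  assert (0 < Im (2 * t))%R as ht2 by (destruct t; simpl in *; lra).
  set (f := fun p : Z * Z => E (t * (IZR (fst p) + a) ^ 2 + 2 * (IZR (fst p) + a) * x)
                   * E (t * (IZR (snd p) + b) ^ 2 + 2 * (IZR (snd p) + b) * y)).
  assert (has_sum f (Theta a x t * Theta b y t)) as Hf
    by (apply (has_sum_prod _ _ _ _ (Theta_has_sum a x t ht) (Theta_has_sum b y t ht))).
  set (fe := fun p : Z * Z => if Z.even (fst p - snd p) then f p else 0).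
  set (fo := fun p : Z * Z => if Z.even (fst p - snd p) then RtoC 0 else f p).
  assert (summable fe) as Hfe.
  { apply summable_le with f; [apply Hf|]; intros p; unfold fe; destruct (Z.even _); [apply Rle_refl|].
    rewrite Cmod_0; apply Cmod_ge_0. }
  assert (summable fo) as Hfo.
  { apply summable_le with f; [apply Hf|]; intros p; unfold fo; destruct (Z.even _); [|apply Rle_refl].
    rewrite Cmod_0; apply Cmod_ge_0. }
  apply summable_has_sum in Hfe, Hfo.
  transitivity (tsum fe + tsum fo).
  { apply has_sum_unique with f; [exact Hf|].
    apply has_sum_ext with (fun p => fe p + fo p); [|apply has_sum_plus; assumption].
    intros p; unfold fe, fo; destruct (Z.even _); ring. }
  f_equal.
  - set (e := fun p : Z * Z => (fst p + snd p, fst p - snd p)%Z).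
    apply has_sum_unique with (fun p => fe (e p)).
    + apply has_sum_inj; [| |exact Hfe].
      * intros [i j] [k l] h; unfold e in h; simpl in h; injection h; intros.
        f_equal; lia.
      * intros [i j]; unfold fe, e; simpl.
        destruct (Z.even (i - j)) eqn:he; [left|right; easy].
        apply Z.even_spec in he as [k hk]; exists (j + k, k)%Z; simpl; f_equal; lia.
    + eapply has_sum_ext;
        [|apply (has_sum_prod _ _ _ _ (Theta_has_sum ((a + b) / 2) (x + y) (2 * t) ht2)
             (Theta_has_sum ((a - b) / 2) (x - y) (2 * t) ht2))].
      intros [s d]; unfold fe, e, f; simpl.
      replace (s + d - (s - d))%Z with (2 * d)%Z by lia; rewrite Z.even_mul; simpl orb.
      cbv iota; rewrite <- !E_plus, plus_IZR, minus_IZR, RtoC_plus, RtoC_minus.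
      f_equal; field.
  - set (e := fun p : Z * Z => (fst p + snd p + 1, fst p - snd p)%Z).
    apply has_sum_unique with (fun p => fo (e p)).
    + apply has_sum_inj; [| |exact Hfo].
      * intros [i j] [k l] h; unfold e in h; simpl in h; injection h; intros.
        f_equal; lia.
      * intros [i j]; unfold fo, e; simpl.
        destruct (Z.even (i - j)) eqn:he; [right; easy|left].
        rewrite <- Z.negb_odd in he; apply Bool.negb_false_iff in he.
        apply Z.odd_spec in he as [k hk]; exists (j + k, k)%Z; simpl; f_equal; lia.
    + eapply has_sum_ext;
        [|apply (has_sum_prod _ _ _ _ (Theta_has_sum ((a + b + 1) / 2) (x + y) (2 * t) ht2)
             (Theta_has_sum ((a - b + 1) / 2) (x - y) (2 * t) ht2))].
      intros [s d]; unfold fo, e, f; simpl.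
      replace (s + d + 1 - (s - d))%Z with (2 * d + 1)%Z by lia.
      rewrite Z.even_add, Z.even_mul; simpl orb; simpl Bool.eqb.
      cbv iota; rewrite <- !E_plus, !plus_IZR, minus_IZR, !RtoC_plus, RtoC_minus.
      f_equal; field.
Qed.

Lemma INR_2_Z (n : nat) : RtoC (INR n) = RtoC (IZR (Z.of_nat n)).
Proof. rewrite INR_IZR_INZ; easy. Qed.

Lemma Csin_E (x : C) : Csin (PI * x) = (E x - E (- x)) / (2 * Ci).
Proof. unfold Csin, E; do 2 f_equal; [|f_equal]; f_equal; ring. Qed.

Lemma E_nat (n : nat) : E (INR n) = (- (1)) ^ n.
Proof.
  induction n as [|n IH]; [apply E_0|].
  rewrite S_INR, RtoC_plus, E_plus, IH, E_1, Cpow_S; ring.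
Qed.

Lemma E_half : E (1 / 2) = Ci.
Proof.
  replace (1 / 2) with (RtoC (1 / 2)) by (rewrite RtoC_div; [easy|lra]).
  rewrite E_real; replace (PI * (1 / 2))%R with (PI / 2)%R by field.
  rewrite cos_PI2, sin_PI2; easy.
Qed.

(** The terms of index [n] and [- 1 - n] of the theta series with
    characteristic [1/2] combine into one term of the sine series. *)
Lemma theta1_Theta (z s : C) : (0 < Im s)%R -> theta1 (PI * z) s = - Theta (1 / 2) (z + 1 / 2) s.
Proof.
  intros hs; unfold theta1, CSeries.
  set (f := fun n : Z => E (s * (IZR n + 1 / 2) ^ 2 + 2 * (IZR n + 1 / 2) * (z + 1 / 2))).
  assert (has_sum f (Theta (1 / 2) (z + 1 / 2) s)) as Hf by (apply Theta_has_sum, hs).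
  set (fp := fun n : Z => if (0 <=? n)%Z then f n else 0).
  set (fm := fun n : Z => if (0 <=? n)%Z then RtoC 0 else f n).
  assert (summable fp) as Hfp.
  { apply summable_le with f; [apply Hf|]; intros p; unfold fp; destruct (Z.leb _ _); [apply Rle_refl|].
    rewrite Cmod_0; apply Cmod_ge_0. }
  assert (summable fm) as Hfm.
  { apply summable_le with f; [apply Hf|]; intros p; unfold fm; destruct (Z.leb _ _); [|apply Rle_refl].
    rewrite Cmod_0; apply Cmod_ge_0. }
  apply summable_has_sum in Hfp, Hfm.
  assert (Theta (1 / 2) (z + 1 / 2) s = tsum fp + tsum fm) as HV.
  { apply has_sum_unique with f; [exact Hf|].
    apply has_sum_ext with (fun p => fp p + fm p); [|apply has_sum_plus; assumption].
    intros p; unfold fp, fm; destruct (Z.leb _ _); ring. }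
  apply (has_sum_inj Z.of_nat) in Hfp; [|intros i j h; lia|].
  2:{ intros j; unfold fp; destruct (Z.leb_spec 0 j); [left|right; easy].
      exists (Z.to_nat j); lia. }
  apply (has_sum_inj (fun n : nat => (- 1 - Z.of_nat n)%Z)) in Hfm; [|intros i j h; lia|].
  2:{ intros j; unfold fm; destruct (Z.leb_spec 0 j); [right; easy|left].
      exists (Z.to_nat (- 1 - j)); lia. }
  assert (Ci * Ci = - (1)) as hi by (apply injective_projections; simpl; ring).
  pose proof Ci_nz as hi0.
  rewrite (CLim_seq_of_Clim _ (- (1) / 2 * Theta (1 / 2) (z + 1 / 2) s)); [field|].
  apply has_sum_nat_Clim; rewrite HV.
  eapply has_sum_ext; [|apply has_sum_scal, (has_sum_plus _ _ _ _ Hfp Hfm)].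
  intros n; unfold fp, fm; cbv beta.
  destruct (Z.leb_spec 0 (Z.of_nat n)); [|lia].
  destruct (Z.leb_spec 0 (- 1 - Z.of_nat n)); [lia|].
  replace ((2 * INR n + 1) * (PI * z)) with (PI * ((2 * INR n + 1) * z)) by ring.
  rewrite Csin_E, <- E_nat; unfold f.
  replace (Cexp _) with (E (s * (INR n + 1 / 2) ^ 2)) by (unfold E; f_equal; field).
  rewrite minus_IZR, RtoC_minus, <- INR_2_Z.
  replace (s * (INR n + 1 / 2) ^ 2 + 2 * (INR n + 1 / 2) * (z + 1 / 2))
    with (s * (INR n + 1 / 2) ^ 2 + (2 * INR n + 1) * z + (INR n + 1 / 2)) by field.
  replace (s * (-1 - INR n + 1 / 2) ^ 2 + 2 * (-1 - INR n + 1 / 2) * (z + 1 / 2))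
    with (s * (INR n + 1 / 2) ^ 2 + - ((2 * INR n + 1) * z) + (INR n + 1 / 2) + - (1)
          + - (2 * INR n)) by field.
  rewrite !E_plus, E_half, (E_opp 1), E_1, (E_opp (2 * INR n)), INR_2_Z, E_2Z.
  transitivity (- (1) / 2 * (E (s * (IZR (Z.of_nat n) + 1 / 2) ^ 2)
     * E ((2 * IZR (Z.of_nat n) + 1) * z) * E (IZR (Z.of_nat n)) * Ci
     - E (s * (IZR (Z.of_nat n) + 1 / 2) ^ 2)
     * E (- ((2 * IZR (Z.of_nat n) + 1) * z)) * E (IZR (Z.of_nat n)) * Ci)).
  - field; apply C1_nz.
  - assert (/ (2 * Ci) = - (1) / 2 * Ci) as hinv.
    { transitivity (- (Ci * Ci) / (2 * Ci)); [rewrite hi; field; exact hi0|field; exact hi0]. }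
    unfold Cdiv in *; rewrite hinv; ring.
Qed.

(** * Riemann sums of Gaussians *)

Lemma Rabs_sin_le (b : R) : (Rabs (sin b) <= Rabs b)%R.
Proof.
  destruct (Rtotal_order b 0) as [h|[->|h]].
  - pose proof (sin_gt_x b h); pose proof (SIN_bound b).
    rewrite (Rabs_left b h); apply Rabs_le; split; [lra|].
    destruct (Rle_lt_dec (-1) b) as [h1|h1]; [|lra].
    pose proof (sin_lt_0_var b) as h2; pose proof PI2_1; lra.
  - rewrite sin_0; lra.
  - pose proof (sin_lt_x b h); pose proof (SIN_bound b).
    rewrite (Rabs_pos_eq b) by lra; apply Rabs_le; split; [|lra].
    destruct (Rle_lt_dec b 1) as [h1|h1]; [|lra].
    pose proof (sin_gt_0 b h) as h2; pose proof PI2_1; lra.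
Qed.

Lemma sin_lower (a : R) : (0 <= a)%R -> (a <= 4)%R -> (a - a ^ 3 / 6 <= sin a)%R.
Proof.
  intros h0 h4; pose proof (proj1 (pre_sin_bound a 0 h0 h4)) as h.
  unfold sin_approx, sin_term in h; simpl in h.
  replace (a - a ^ 3 / 6)%R with (1 * (a * 1 / 1) + -1 * 1 * (a * (a * (a * 1)) / (1 + 1 + 1 + 1 + 1 + 1)))%R
    by (field; lra).
  lra.
Qed.

Lemma Rabs_sin_sub_le (b : R) : (Rabs (sin b - b) <= b ^ 2)%R.
Proof.
  assert (forall c, (0 <= c)%R -> (Rabs (sin c - c) <= c ^ 2)%R) as K.
  { intros c hc; pose proof (Rabs_sin_le c) as h1.
    rewrite (Rabs_pos_eq c hc) in h1; apply Rabs_le_between in h1.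
    apply Rabs_le; split; [|nra].
    destruct (Rle_lt_dec c 4) as [h4|h4].
    - pose proof (sin_lower c hc h4); nra.
    - pose proof (SIN_bound c); nra. }
  destruct (Rle_lt_dec 0 b) as [h|h]; [auto|].
  specialize (K (- b)%R ltac:(lra)); rewrite sin_neg in K.
  rewrite <- Rabs_Ropp; replace (- (sin b - b))%R with (- sin b - - b)%R by ring.
  eapply Rle_trans; [exact K|]; right; ring.
Qed.

Lemma one_sub_cos (b : R) : (1 - cos b = 2 * sin (b / 2) ^ 2)%R.
Proof.
  replace b with (2 * (b / 2))%R at 1 by field; rewrite cos_2a_sin; ring.
Qed.

Lemma Rabs_cos_sub_le (b : R) : (Rabs (cos b - 1) <= b ^ 2)%R.
Proof.
  replace (cos b - 1)%R with (- (1 - cos b))%R by ring.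
  rewrite Rabs_Ropp, one_sub_cos, Rabs_pos_eq by (pose proof (pow2_ge_0 (sin (b / 2))); lra).
  pose proof (pow_maj_Rabs (Rabs (b / 2)) (sin (b / 2)) 2 (Rabs_sin_le _)) as h.
  apply Rle_trans with (2 * Rabs (b / 2) ^ 2)%R.
  - pose proof (Rle_abs (sin (b / 2) ^ 2)); lra.
  - rewrite pow2_abs; nra.
Qed.

Lemma exp_sub_1_le (a : R) : (Rabs (exp a - 1) <= Rabs a * exp (Rabs a))%R.
Proof.
  pose proof (exp_ineq1_le a) as h1; pose proof (exp_ineq1_le (- a)) as h2.
  pose proof (exp_pos a).
  assert (exp a * exp (- a) = 1)%R as h3 by (rewrite <- exp_plus, Rplus_opp_r; apply exp_0).
  destruct (Rle_lt_dec 0 a) as [h|h].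
  - rewrite (Rabs_pos_eq a h); apply Rabs_le; split; [nra|].
    assert (exp a * (1 + - a) <= 1)%R by (rewrite <- h3; apply Rmult_le_compat_l; lra); nra.
  - rewrite (Rabs_left a h); pose proof (exp_ineq1_le (- a)).
    apply Rabs_le; split; nra.
Qed.

Lemma exp_taylor_le (a : R) : (Rabs (exp a - 1 - a) <= a ^ 2 * exp (Rabs a))%R.
Proof.
  pose proof (exp_ineq1_le a) as h1; pose proof (exp_ineq1_le (- a)) as h2.
  pose proof (exp_sub_1_le a) as h3.
  pose proof (exp_pos a).
  assert (exp a * exp (- a) = 1)%R as h4 by (rewrite <- exp_plus, Rplus_opp_r; apply exp_0).
  assert (exp a * (1 + - a) <= 1)%R as h5 by (rewrite <- h4; apply Rmult_le_compat_l; lra).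
  apply Rabs_le; split; [pose proof (exp_pos (Rabs a)); nra|].
  apply Rle_trans with (a * (exp a - 1))%R; [nra|].
  apply Rle_trans with (Rabs a * Rabs (exp a - 1))%R.
  - rewrite <- Rabs_mult; apply Rle_abs.
  - replace (a ^ 2)%R with (Rabs a * Rabs a)%R by (rewrite <- Rabs_mult, Rabs_pos_eq; nra).
    rewrite Rmult_assoc; apply Rmult_le_compat_l; [apply Rabs_pos|exact h3].
Qed.

Lemma Cexp_taylor_le (s : C) : (Cmod (Cexp s - 1 - s) <= 5 * Cmod s ^ 2 * exp (Cmod s))%R.
Proof.
  pose proof (re_le_Cmod s) as ha; pose proof (Im_le_Cmod s) as hb.
  unfold Cexp; destruct s as [a b]; simpl Re in *; simpl Im in *.
  set (m := Cmod (a, b)) in *; set (X := exp m).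
  assert (0 <= m)%R as hm by apply Cmod_ge_0.
  replace ((exp a * cos b, exp a * sin b)%R - 1 - (a, b)) with
    (RtoC (exp a - 1 - a) + RtoC (exp a - 1) * (RtoC (cos b - 1) + Ci * RtoC (sin b))
     + RtoC (cos b - 1) + Ci * RtoC (sin b - b))
    by (apply injective_projections; simpl; ring).
  assert (1 <= X)%R as hX by (pose proof (exp_ineq1_le m); unfold X; lra).
  assert (exp (Rabs a) <= X)%R as hXa by (apply exp_le, ha).
  pose proof (exp_pos (Rabs a)); pose proof (Rabs_pos a); pose proof (Rabs_pos b).
  assert (a ^ 2 <= m ^ 2)%R as ha2 by (rewrite <- pow2_abs; apply pow_incr; lra).
  assert (b ^ 2 <= m ^ 2)%R as hb2 by (rewrite <- pow2_abs; apply pow_incr; lra).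
  assert (Rabs (exp a - 1 - a) <= m ^ 2 * X)%R as h1.
  { eapply Rle_trans; [apply exp_taylor_le|].
    apply Rmult_le_compat; try lra; apply pow2_ge_0. }
  assert (Rabs (exp a - 1) <= m * X)%R as h2.
  { eapply Rle_trans; [apply exp_sub_1_le|]; apply Rmult_le_compat; lra. }
  assert (Rabs (cos b - 1) <= m ^ 2)%R as h3
    by (eapply Rle_trans; [apply Rabs_cos_sub_le|exact hb2]).
  assert (Rabs (cos b - 1) <= m)%R as h3'.
  { destruct (Rle_lt_dec m 1) as [h|h]; [nra|].
    pose proof (COS_bound b); destruct (Rle_lt_dec m 2); [|apply Rabs_le; lra].
    replace (cos b - 1)%R with (- (1 - cos b))%R by ring.
    rewrite Rabs_Ropp, one_sub_cos, Rabs_pos_eq by (pose proof (pow2_ge_0 (sin (b / 2))); lra).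
    assert (Rabs (sin (b / 2)) <= m / 2)%R as hs.
    { eapply Rle_trans; [apply Rabs_sin_le|].
      unfold Rdiv; rewrite Rabs_mult, (Rabs_pos_eq (/ 2)) by lra; lra. }
    assert (Rabs (sin (b / 2)) <= 1)%R by (apply Rabs_le, SIN_bound).
    pose proof (Rabs_pos (sin (b / 2))).
    rewrite <- pow2_abs; nra. }
  assert (Rabs (sin b) <= m)%R as h4 by (eapply Rle_trans; [apply Rabs_sin_le|exact hb]).
  assert (Rabs (sin b - b) <= m ^ 2)%R as h5
    by (eapply Rle_trans; [apply Rabs_sin_sub_le|exact hb2]).
  assert (Cmod (RtoC (cos b - 1) + Ci * RtoC (sin b)) <= 2 * m)%R as h6.
  { eapply Rle_trans; [apply Cmod_triangle|]; rewrite Cmod_mult, Cmod_Ci, !Cmod_R; lra. }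
  eapply Rle_trans; [apply Cmod_triangle|].
  rewrite (Cmod_mult Ci), Cmod_Ci, (Cmod_R (sin b - b)).
  eapply Rle_trans; [apply Rplus_le_compat_r, Cmod_triangle|].
  rewrite (Cmod_R (cos b - 1)).
  eapply Rle_trans; [apply Rplus_le_compat_r, Rplus_le_compat_r, Cmod_triangle|].
  rewrite (Cmod_mult (RtoC (exp a - 1))), !Cmod_R.
  assert (Rabs (exp a - 1) * Cmod (RtoC (cos b - 1) + Ci * RtoC (sin b)) <= m * X * (2 * m))%R
    by (apply Rmult_le_compat; try apply Rabs_pos; try apply Cmod_ge_0; assumption).
  pose proof (pow2_ge_0 m); nra.
Qed.

(** A second order Taylor bound for the Gaussian with base points in a strip;
    the factor [exp (- Rabs x)] makes the error summable along the line. *)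
Lemma gauss_taylor (t : C) (W : R) : (0 < Im t)%R -> (0 <= W)%R ->
  exists D, (0 < D)%R /\ forall (x : R) (w u : C), (Cmod w <= W)%R -> (Cmod u <= 1)%R ->
    (Cmod (E (t * (x + w + u) ^ 2) - E (t * (x + w) ^ 2)
           - u * (2 * PI * Ci * t * (x + w) * E (t * (x + w) ^ 2)))
     <= D * Cmod u ^ 2 * exp (- Rabs x))%R.
Proof.
  intros ht hW.
  pose proof PI_RGT_0 as hpi; pose proof (Cmod_ge_0 t) as hct.
  set (A := (PI * Cmod t * (2 * W + 2))%R).
  assert (0 <= PI * Cmod t)%R as hpt by (apply Rmult_le_pos; lra).
  assert (0 <= A)%R as hA by (apply Rmult_le_pos; lra).
  destruct (gauss_bound t W (3 + A) ht hW) as [M [hM HM]]; [lra|].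
  exists (M * (5 * A ^ 2 * exp A + PI * Cmod t + 1))%R.
  pose proof (exp_pos A); pose proof (pow2_ge_0 A).
  split; [apply Rmult_lt_0_compat; [exact hM|]; nra|].
  intros x w u hw hu; set (g := E (t * (x + w) ^ 2)).
  set (s := PI * Ci * t * (2 * (x + w) * u + u ^ 2)).
  replace (E (t * (x + w + u) ^ 2)) with (g * Cexp s)
    by (unfold g, E, s; rewrite <- Cexp_plus; f_equal; ring).
  replace (g * Cexp s - g - u * (2 * PI * Ci * t * (x + w) * g))
    with (g * ((Cexp s - 1 - s) + PI * Ci * t * u ^ 2)) by (unfold s; ring).
  rewrite Cmod_mult.
  pose proof (Cmod_ge_0 u) as hu0; pose proof (Rabs_pos x) as hx.
  assert (Cmod s <= A * (1 + Rabs x) * Cmod u)%R as hs.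
  { unfold s; rewrite !Cmod_mult, Cmod_Ci, Cmod_R, (Rabs_pos_eq PI) by lra.
    replace (A * (1 + Rabs x) * Cmod u)%R
      with (PI * 1 * Cmod t * ((2 * W + 2) * (1 + Rabs x) * Cmod u))%R by (unfold A; ring).
    apply Rmult_le_compat_l; [lra|].
    replace (2 * (x + w) * u + u ^ 2) with ((2 * (x + w) + u) * u) by ring.
    rewrite Cmod_mult; apply Rmult_le_compat_r; [exact hu0|].
    eapply Rle_trans; [apply Cmod_triangle|]; rewrite Cmod_mult, Cmod_R.
    pose proof (Cmod_triangle x w) as h; rewrite Cmod_R in h.
    rewrite (Rabs_pos_eq 2) by lra; nra. }
  set (Y := Rabs x) in *.
  assert (Cmod s <= A * (1 + Y))%R as hs1.
  { eapply Rle_trans; [exact hs|]; rewrite <- (Rmult_1_r (A * (1 + Y))) at 2.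
    apply Rmult_le_compat_l; [apply Rmult_le_pos; lra|exact hu]. }
  assert (Cmod s ^ 2 <= A ^ 2 * (1 + Y) ^ 2 * Cmod u ^ 2)%R as hs2.
  { replace (A ^ 2 * (1 + Y) ^ 2 * Cmod u ^ 2)%R with ((A * (1 + Y) * Cmod u) ^ 2)%R by ring.
    apply pow_incr; split; [apply Cmod_ge_0|exact hs]. }
  assert ((1 + Y) ^ 2 <= exp (2 * Y))%R as hY.
  { replace (2 * Y)%R with (Y + Y)%R by ring; rewrite exp_plus.
    pose proof (exp_ineq1_le Y); simpl; rewrite Rmult_1_r; apply Rmult_le_compat; lra. }
  assert (exp (Cmod s) <= exp A * exp (A * Y))%R as hes
    by (rewrite <- exp_plus; apply exp_le; lra).
  assert (0 <= Cmod u ^ 2)%R by apply pow2_ge_0.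
  assert (1 <= exp ((2 + A) * Y))%R as h1.
  { rewrite <- exp_0; apply exp_le, Rmult_le_pos; lra. }
  assert (Cmod (Cexp s - 1 - s + PI * Ci * t * u ^ 2)
    <= (5 * A ^ 2 * exp A + PI * Cmod t) * Cmod u ^ 2 * exp ((2 + A) * Y))%R as hmain.
  { eapply Rle_trans; [apply Cmod_triangle|].
    rewrite (Cmod_mult _ (u ^ 2)), !Cmod_mult, Cmod_Ci, Cmod_R, (Rabs_pos_eq PI), Cmod_pow by lra.
    assert (Cmod (Cexp s - 1 - s) <= 5 * A ^ 2 * exp A * Cmod u ^ 2 * exp ((2 + A) * Y))%R.
    { eapply Rle_trans; [apply Cexp_taylor_le|].
      replace (5 * A ^ 2 * exp A * Cmod u ^ 2 * exp ((2 + A) * Y))%R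
        with (5 * (A ^ 2 * exp (2 * Y) * Cmod u ^ 2) * (exp A * exp (A * Y)))%R.
      - apply Rmult_le_compat.
        + pose proof (pow2_ge_0 (Cmod s)); lra.
        + left; apply exp_pos.
        + apply Rmult_le_compat_l; [lra|].
          eapply Rle_trans; [exact hs2|].
          apply Rmult_le_compat_r; [assumption|]; apply Rmult_le_compat_l; assumption.
        + exact hes.
      - replace ((2 + A) * Y)%R with (2 * Y + A * Y)%R by ring; rewrite exp_plus; ring. }
    assert (PI * 1 * Cmod t * Cmod u ^ 2 * 1
      <= PI * 1 * Cmod t * Cmod u ^ 2 * exp ((2 + A) * Y))%R.
    { apply Rmult_le_compat_l; [|exact h1]; apply Rmult_le_pos; lra. }
    lra. }
  specialize (HM x w hw); fold g Y in HM.
  apply Rle_trans with (M * exp (- (3 + A) * Y)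
    * ((5 * A ^ 2 * exp A + PI * Cmod t) * Cmod u ^ 2 * exp ((2 + A) * Y)))%R.
  - apply Rmult_le_compat; try apply Cmod_ge_0; assumption.
  - replace (exp (- Y)) with (exp (- (3 + A) * Y) * exp ((2 + A) * Y))%R
      by (rewrite <- exp_plus; f_equal; ring).
    pose proof (exp_pos (- (3 + A) * Y)); pose proof (exp_pos ((2 + A) * Y)).
    assert (0 <= M * Cmod u ^ 2 * (exp (- (3 + A) * Y) * exp ((2 + A) * Y)))%R
      by (apply Rmult_le_pos; apply Rmult_le_pos; lra).
    nra.
Qed.

(** The constant is uniform in the mesh [1 / N]: the sum of the majorant is
    geometric with ratio [exp (- 1 / N)]. *)
Lemma mesh_bound (N : nat) (c : R) (f : Z -> C) :
  (1 <= N)%nat -> (0 <= c)%R ->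
  (forall m, (Cmod (f m) <= c * exp (- Rabs (IZR m / INR N)))%R) ->
  summable f /\ forall s, has_sum f s -> (Cmod s <= 4 * c * INR N)%R.
Proof.
  intros hN hc hf.
  assert (1 <= INR N)%R as hN1 by (apply (le_INR 1), hN).
  assert (forall l, NoDup l -> (lsumR (fun m => Cmod (f m)) l <= 4 * c * INR N)%R) as K.
  { replace (4 * c * INR N)%R with (2 * c * INR N + 2 * c * INR N)%R by ring.
    set (r := exp (- / INR N)).
    assert (0 < / INR N)%R as hi by (apply Rinv_0_lt_compat; lra).
    assert (0 < r)%R as hr0 by apply exp_pos.
    assert (r < 1)%R as hr1 by (rewrite <- exp_0; apply exp_increasing; lra).
    assert (/ (1 - r) <= 2 * INR N)%R as hg.
    { (* 1 + y <= exp y at y = 1 / N gives 1 - r >= 1 / (N + 1) *)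
      pose proof (exp_ineq1_le (/ INR N)) as h.
      assert (r * exp (/ INR N) = 1)%R as hre
        by (unfold r; rewrite <- exp_plus, Rplus_opp_l; apply exp_0).
      assert (r * (1 + / INR N) <= 1)%R as h1
        by (rewrite <- hre; apply Rmult_le_compat_l; lra).
      assert (/ (2 * INR N) <= 1 - r)%R as h2.
      { apply Rmult_le_reg_r with (INR N + 1)%R; [lra|].
        apply Rle_trans with 1%R.
        - apply Rmult_le_reg_l with (2 * INR N)%R; [lra|].
          rewrite <- Rmult_assoc, Rinv_r; lra.
        - assert (r * (1 + / INR N) * INR N <= 1 * INR N)%R as h3
            by (apply Rmult_le_compat_r; lra).
          replace (r * (1 + / INR N) * INR N)%R with (r * (INR N + 1))%R in h3
            by (field; lra).
          lra. }
      rewrite <- (Rinv_inv (2 * INR N)); apply Rinv_le_contravar; [|exact h2].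
      apply Rinv_0_lt_compat; lra. }
    assert (forall n : nat, exp (- (INR n / INR N)) = (r ^ n)%R) as hpow.
    { induction n as [|n IH]; [simpl; unfold Rdiv; rewrite Rmult_0_l, Ropp_0; apply exp_0|].
      simpl pow; rewrite <- IH; unfold r; rewrite <- exp_plus, S_INR; f_equal; field; lra. }
    assert (forall n, (0 <= INR n / INR N)%R) as hpos
      by (intros n; apply Rdiv_le_0_compat; [apply pos_INR|lra]).
    assert (forall l, NoDup l -> (lsumR (fun n => c * r ^ n)%R l <= 2 * c * INR N)%R) as hgeo.
    { apply lsumR_nat_le.
      - intros n; apply Rmult_le_pos; [exact hc|apply pow_le; lra].
      - intros n; rewrite lsumR_scal.
        replace (2 * c * INR N)%R with (c * (2 * INR N))%R by ring.
        apply Rmult_le_compat_l; [exact hc|].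
        eapply Rle_trans; [apply lsumR_geom; lra|exact hg]. }
    apply lsumR_Z_le; intros l hl; (eapply Rle_trans; [|apply (hgeo l hl)]);
      apply lsumR_le; intros n _; (eapply Rle_trans; [apply hf|]);
      rewrite <- hpow; apply Req_le; do 3 f_equal.
    - rewrite <- INR_IZR_INZ; apply Rabs_pos_eq, hpos.
    - rewrite opp_IZR, <- INR_IZR_INZ, Rdiv_opp_l, Rabs_Ropp; apply Rabs_pos_eq, hpos. }
  split; [exists (4 * c * INR N)%R; exact K|].
  intros s hs; apply has_sum_Cmod_le with f; assumption.
Qed.

(** [N] times the Riemann sum with mesh [1 / N] of the Gaussian along the line
    through [w] parallel to the real axis. *)
Definition gsum (t : C) (N : nat) (w : C) : C :=
  tsum (fun m : Z => E (t * ((IZR m / INR N)%R + w) ^ 2)).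

Lemma gsum_has_sum (t : C) (N : nat) (w : C) : (0 < Im t)%R -> (1 <= N)%nat ->
  has_sum (fun m : Z => E (t * ((IZR m / INR N)%R + w) ^ 2)) (gsum t N w).
Proof.
  intros ht hN; apply summable_has_sum.
  destruct (gauss_bound t (Cmod w) 1 ht (Cmod_ge_0 w)) as [M [hM H]]; [lra|].
  apply (mesh_bound N M); [exact hN|lra|].
  intros m; eapply Rle_trans; [apply (H _ _ (Rle_refl _))|].
  apply Req_le; do 2 f_equal; ring.
Qed.

Lemma mesh_succ (N : nat) (m : Z) (w : C) : (1 <= N)%nat ->
  RtoC (IZR (m + 1) / INR N) + w = RtoC (IZR m / INR N) + w + RtoC (/ INR N).
Proof.
  intros hN; assert (INR N <> 0%R) by (apply not_0_INR; lia).
  replace (IZR (m + 1) / INR N)%R with (IZR m / INR N + / INR N)%R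
    by (rewrite plus_IZR; field; assumption).
  rewrite RtoC_plus; ring.
Qed.

Lemma gsum_translate (t : C) (N : nat) (w : C) : (0 < Im t)%R -> (1 <= N)%nat ->
  has_sum (fun m : Z => E (t * ((IZR m / INR N)%R + w + (/ INR N)%R) ^ 2)) (gsum t N w).
Proof.
  intros ht hN.
  apply has_sum_ext with (fun m : Z => E (t * ((IZR (m + 1) / INR N)%R + w) ^ 2)).
  - intros m; rewrite mesh_succ by exact hN; easy.
  - apply (has_sum_inj (fun m : Z => (m + 1)%Z)
      (fun m => E (t * ((IZR m / INR N)%R + w) ^ 2))).
    + intros i j h; lia.
    + intros j; left; exists (j - 1)%Z; lia.
    + apply gsum_has_sum; assumption.
Qed.

(** The sum of the derivative over the mesh is almost a telescoping sum, as the
    translation by one mesh step leaves [gsum] invariant; hence a translation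
    by [u] of order [1 / N] changes [gsum] by order [1 / N] only. *)
Lemma gsum_step (t : C) (W : R) : (0 < Im t)%R -> (0 <= W)%R ->
  exists D, (0 < D)%R /\ forall (N : nat) (w u : C), (1 <= N)%nat ->
    (Cmod w <= W)%R -> (Cmod u <= 1)%R ->
    (Cmod (gsum t N (w + u) - gsum t N w) <= D * (INR N * Cmod u ^ 2 + Cmod u))%R.
Proof.
  intros ht hW; destruct (gauss_taylor t W ht hW) as [D [hD HD]].
  exists (4 * D)%R; split; [lra|]; intros N w u hN hw hu.
  assert (1 <= INR N)%R as hN1 by (apply (le_INR 1), hN).
  assert (0 < / INR N)%R as hi by (apply Rinv_0_lt_compat; lra).
  assert (Cmod (/ INR N)%R = / INR N)%R as hci by (rewrite Cmod_R; apply Rabs_pos_eq; lra).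
  set (g := fun m : Z => E (t * ((IZR m / INR N)%R + w) ^ 2)).
  (* [psi] is the derivative of [w |-> g m], and [r v] is the error of the first
     order Taylor formula for the translation by [v] *)
  set (psi := fun m : Z => 2 * PI * Ci * t * ((IZR m / INR N)%R + w) * g m).
  set (r := fun (v : C) (m : Z) => E (t * ((IZR m / INR N)%R + w + v) ^ 2) - g m - v * psi m).
  assert (forall v, (Cmod v <= 1)%R ->
     summable (r v) /\ forall s, has_sum (r v) s -> (Cmod s <= 4 * (D * Cmod v ^ 2) * INR N)%R)
    as Hr.
  { intros v hv; apply mesh_bound; [exact hN| |].
    - apply Rmult_le_pos; [lra|apply pow2_ge_0].
    - intros m; apply HD; assumption. }
  assert (Cmod (/ INR N)%R <= 1)%R as hi1.
  { rewrite hci; rewrite <- Rinv_1; apply Rinv_le_contravar; lra. }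
  destruct (Hr _ hi1) as [Hr1 Hr2].
  apply summable_has_sum in Hr1; set (R1 := tsum (r (/ INR N)%R)) in *.
  specialize (Hr2 R1 Hr1); rewrite hci in Hr2.
  assert (RtoC (/ INR N) <> 0) as hi0 by (intros h; apply RtoC_inj in h; lra).
  assert (has_sum psi (- INR N * R1)) as Hpsi.
  { eapply has_sum_ext with
      (fun m => INR N * (E (t * ((IZR m / INR N)%R + w + (/ INR N)%R) ^ 2)
          + - (1) * g m + - (1) * r (/ INR N)%R m)).
    - intros m; unfold r.
      transitivity (RtoC (INR N) * RtoC (/ INR N) * psi m); [ring|].
      rewrite <- RtoC_mult, Rinv_r by lra; ring.
    - replace (- INR N * R1) with
        (INR N * (gsum t N w + - (1) * gsum t N w + - (1) * R1)) by ring.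
      apply has_sum_scal; apply has_sum_plus; [apply has_sum_plus|].
      + apply gsum_translate; assumption.
      + apply has_sum_scal, gsum_has_sum; assumption.
      + apply has_sum_scal, Hr1. }
  destruct (Hr u hu) as [Hu1 Hu2].
  apply summable_has_sum in Hu1; set (R2 := tsum (r u)) in *; specialize (Hu2 R2 Hu1).
  assert (gsum t N (w + u) - gsum t N w = R2 + u * (- INR N * R1)) as ->.
  { apply has_sum_unique with (fun m => E (t * ((IZR m / INR N)%R + (w + u)) ^ 2) + - (1) * g m).
    - replace (gsum t N (w + u) - gsum t N w) with (gsum t N (w + u) + - (1) * gsum t N w) by ring.
      apply has_sum_plus; [|apply has_sum_scal]; apply gsum_has_sum; assumption.
    - eapply has_sum_ext; [|apply has_sum_plus; [exact Hu1|apply has_sum_scal, Hpsi]].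
      intros m; unfold r; rewrite Cplus_assoc; ring. }
  eapply Rle_trans; [apply Cmod_triangle|].
  rewrite !Cmod_mult, Cmod_opp, Cmod_R, Rabs_pos_eq by lra.
  assert (INR N * Cmod R1 <= 4 * D)%R.
  { apply Rle_trans with (INR N * (4 * (D * (/ INR N) ^ 2) * INR N))%R;
      [apply Rmult_le_compat_l; lra|]; right; field; lra. }
  pose proof (Cmod_ge_0 u).
  assert (Cmod u * (INR N * Cmod R1) <= Cmod u * (4 * D))%R by (apply Rmult_le_compat_l; lra).
  lra.
Qed.

(** Cut the translation by [v] into [N] steps of length [Cmod v / N]. *)
Lemma gsum_translation_limit (t v : C) : (0 < Im t)%R ->
  exists D, (0 < D)%R /\ forall N : nat, (1 <= N)%nat -> (Cmod v <= INR N)%R ->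
    (Cmod (gsum t N v - gsum t N 0) <= D)%R.
Proof.
  intros ht; pose proof (Cmod_ge_0 v) as hv.
  destruct (gsum_step t (Cmod v) ht hv) as [D [hD HD]].
  exists (D * (Cmod v ^ 2 + Cmod v) + 1)%R; split.
  { pose proof (pow2_ge_0 (Cmod v)); nra. }
  intros N hN hvN.
  assert (1 <= INR N)%R as hN1 by (apply (le_INR 1), hN).
  set (u := v / INR N).
  assert (RtoC (INR N) <> 0) as hN0 by (intros h; apply RtoC_inj in h; lra).
  assert (Cmod u = Cmod v / INR N)%R as hu.
  { unfold u; rewrite Cmod_div by exact hN0; rewrite Cmod_R, Rabs_pos_eq by lra; easy. }
  assert (0 <= Cmod v / INR N)%R as hu0 by (apply Rdiv_le_0_compat; lra).
  assert (forall j : nat, (j <= N)%nat ->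
    (Cmod (gsum t N (INR j * u) - gsum t N 0)
     <= INR j * (D * (INR N * Cmod u ^ 2 + Cmod u)))%R) as K.
  { induction j as [|j IH]; intros hj.
    - simpl INR; rewrite Cmult_0_l, Rmult_0_l.
      replace (gsum t N 0 - gsum t N 0) with (RtoC 0) by ring; rewrite Cmod_0; lra.
    - rewrite S_INR, RtoC_plus.
      replace ((INR j + 1) * u) with (INR j * u + u) by ring.
      eapply Rle_trans; [apply (Cmod_triangle_sub _ (gsum t N (INR j * u)))|].
      assert (Cmod (gsum t N (INR j * u + u) - gsum t N (INR j * u))
        <= D * (INR N * Cmod u ^ 2 + Cmod u))%R as h1.
      { apply HD; [exact hN| |].
        - rewrite Cmod_mult, Cmod_R, hu, Rabs_pos_eq by apply pos_INR.
          assert (INR j <= INR N)%R by (apply le_INR; lia).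
          apply Rle_trans with (INR N * (Cmod v / INR N))%R;
            [apply Rmult_le_compat_r; assumption|right; field; lra].
        - rewrite hu; apply Rmult_le_reg_r with (INR N); [lra|].
          unfold Rdiv; rewrite Rmult_assoc, Rinv_l; lra. }
      specialize (IH ltac:(lia)); lra. }
  specialize (K N (Nat.le_refl _)).
  replace (INR N * u) with v in K by (unfold u; field; exact hN0).
  eapply Rle_trans; [exact K|]; rewrite hu.
  replace (INR N * (D * (INR N * (Cmod v / INR N) ^ 2 + Cmod v / INR N)))%R
    with (D * (Cmod v ^ 2 + Cmod v))%R by (field; lra).
  lra.
Qed.

(** * The transformation of theta constants under inversion of the period *)

(** The discrete Fourier transform of the Gaussian on the mesh [1 / N], times
    [N]; the square is completed already, see [gfourier_has_sum]. *)
Definition gfourier (t : C) (N : nat) (k : Z) : C :=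
  E (- (IZR k ^ 2 / t)) * gsum t N (- (IZR k / t)).

Lemma gfourier_has_sum (t : C) (N : nat) (k : Z) : (0 < Im t)%R -> (1 <= N)%nat ->
  has_sum (fun m : Z => E (t * (IZR m / INR N)%R ^ 2) * E (- (2 * IZR k * (IZR m / INR N)%R)))
    (gfourier t N k).
Proof.
  intros ht hN; unfold gfourier.
  eapply has_sum_ext; [|apply has_sum_scal, gsum_has_sum; assumption].
  intros m; cbv beta; rewrite <- !E_plus; f_equal; field; apply Im_pos_neq_0, ht.
Qed.

Lemma Cmod_E_add_E_opp (r : R) :
  Cmod (E r + E (- r) - 2) = (4 * sin (PI * r / 2) ^ 2)%R.
Proof.
  rewrite <- RtoC_opp, !E_real.
  replace (PI * - r)%R with (- (PI * r))%R by ring; rewrite cos_neg, sin_neg.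
  replace (_ - 2) with (RtoC (- (2 * (1 - cos (PI * r)))))
    by (apply injective_projections; simpl; ring).
  rewrite Cmod_R, Rabs_Ropp, one_sub_cos, Rabs_pos_eq; [ring|].
  pose proof (pow2_ge_0 (sin (PI * r / 2))); lra.
Qed.

Lemma Cmod_E_add_E_opp_ge (r : R) : (Rabs r <= 1)%R ->
  (r ^ 2 / 4 <= Cmod (E r + E (- r) - 2))%R.
Proof.
  intros hr; rewrite Cmod_E_add_E_opp.
  pose proof PI_4 as hp4; pose proof PI2_1 as hp1.
  assert (forall c, (0 <= c <= 1)%R -> (c / 3 <= sin (PI * c / 2))%R) as K.
  { intros c hc; set (a := (PI * c / 2)%R).
    assert (c <= a <= 2 * c)%R as [h1 h2] by (unfold a; nra).
    pose proof (sin_lower a ltac:(lra) ltac:(lra)).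
    assert (a * (a * a) <= a * (2 * 2))%R by (apply Rmult_le_compat_l; nra).
    nra. }
  apply Rabs_le_between in hr.
  destruct (Rle_lt_dec 0 r) as [h|h].
  - specialize (K r ltac:(lra)); nra.
  - specialize (K (- r)%R ltac:(lra)).
    replace (PI * - r / 2)%R with (- (PI * r / 2))%R in K by field; rewrite sin_neg in K; nra.
Qed.

(** Two summations by parts: the second difference of the Gaussian on the mesh
    is of order [1 / N ^ 2]. *)
Lemma gfourier_decay (t : C) : (0 < Im t)%R ->
  exists D, (0 < D)%R /\ forall (N : nat) (k : Z), (1 <= N)%nat -> (2 * Z.abs k <= Z.of_nat N)%Z ->
    (IZR k ^ 2 * Cmod (gfourier t N k) <= D * INR N)%R.
Proof.
  intros ht; destruct (gauss_taylor t 0 ht (Rle_refl _)) as [D [hD HD]].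
  exists (8 * D)%R; split; [lra|]; intros N k hN hk.
  assert (1 <= INR N)%R as hN1 by (apply (le_INR 1), hN).
  set (c := (/ INR N)%R).
  assert (0 < c)%R as hc0 by (apply Rinv_0_lt_compat; lra).
  assert (c <= 1)%R as hc1 by (unfold c; rewrite <- Rinv_1; apply Rinv_le_contravar; lra).
  set (g := fun m : Z => E (t * (IZR m / INR N)%R ^ 2)).
  set (e := fun m : Z => E (- (2 * IZR k * (IZR m / INR N)%R))).
  set (r := (2 * IZR k / INR N)%R).
  pose proof (gfourier_has_sum t N k ht hN) as HG; fold g in HG.
  change (has_sum (fun m => g m * e m) (gfourier t N k)) in HG.
  set (G := gfourier t N k) in *.
  assert (forall m s, e (m + s)%Z = e m * E (- (IZR s * r))) as he.
  { intros m s; unfold e; rewrite <- E_plus; f_equal; unfold r.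
    rewrite <- ?RtoC_mult, <- ?RtoC_opp, <- RtoC_plus; f_equal; rewrite plus_IZR; field; lra. }
  assert (forall s, has_sum (fun m => g (m + s)%Z * e m) (E (IZR s * r) * G)) as HS.
  { intros s.
    apply has_sum_ext with (fun m => E (IZR s * r) * (g (m + s)%Z * e (m + s)%Z)).
    - intros m; rewrite he, E_opp; field; apply E_neq_0.
    - apply has_sum_scal, (has_sum_inj (fun m : Z => (m + s)%Z) (fun m => g m * e m)).
      + intros i j h; lia.
      + intros j; left; exists (j - s)%Z; lia.
      + exact HG. }
  assert (has_sum (fun m => (g (m + 1)%Z + g (m + -1)%Z - 2 * g m) * e m)
     ((E r + E (- r) - 2) * G)) as H2.
  { replace ((E r + E (- r) - 2) * G) with
      (E (1 * r) * G + E (-1 * r) * G + (- 2) * G)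
      by (replace (1 * r) with (RtoC r) by ring; replace (-1 * r) with (- r) by ring; ring).
    eapply has_sum_ext; [|apply has_sum_plus; [apply has_sum_plus; apply HS|apply has_sum_scal, HG]].
    intros m; cbv beta; ring. }
  assert (forall m, (Cmod ((g (m + 1)%Z + g (m + -1)%Z - 2 * g m) * e m)
     <= 2 * D * c ^ 2 * exp (- Rabs (IZR m / INR N)))%R) as Hb.
  { intros m; rewrite Cmod_mult.
    assert (Cmod (e m) = 1)%R as ->.
    { unfold e; rewrite <- RtoC_mult, <- RtoC_mult, <- RtoC_opp, Cmod_E; simpl.
      rewrite Rmult_0_r; apply exp_0. }
    rewrite Rmult_1_r; set (x := (IZR m / INR N)%R).
    assert (forall s : Z, g (m + s)%Z = E (t * (x + 0 + (IZR s * c)%R) ^ 2)) as hg.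
    { intros s; unfold g, x, c; f_equal; f_equal; f_equal.
      rewrite Cplus_0_r, <- RtoC_plus; f_equal; rewrite plus_IZR; field; lra. }
    assert (Cmod 0 <= 0)%R as h00 by (rewrite Cmod_0; lra).
    assert (forall s : Z, (Rabs (IZR s * c) = c)%R -> _) as hT
      by (intros s hs; exact (HD x 0 (IZR s * c)%R h00
            ltac:(rewrite Cmod_R, hs; exact hc1))).
    assert (Rabs (1 * c) = c)%R as h1 by (rewrite Rmult_1_l; apply Rabs_pos_eq; lra).
    assert (Rabs (-1 * c) = c)%R as h2
      by (replace (-1 * c)%R with (- c)%R by ring; rewrite Rabs_Ropp; apply Rabs_pos_eq; lra).
    pose proof (hT 1%Z h1) as T1; pose proof (hT (-1)%Z h2) as T2.
    rewrite <- hg, Cmod_R, h1 in T1; rewrite <- hg, Cmod_R, h2 in T2.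
    assert (g m = E (t * (x + 0) ^ 2)) as hgm by (unfold g, x; rewrite Cplus_0_r; easy).
    rewrite <- hgm in T1, T2.
    set (q := 2 * PI * Ci * t * (x + 0) * g m) in *.
    replace (g (m + 1)%Z + g (m + -1)%Z - 2 * g m) with
      ((g (m + 1)%Z - g m - (1 * c)%R * q) + (g (m + -1)%Z - g m - (-1 * c)%R * q))
      by (rewrite !RtoC_mult; ring).
    eapply Rle_trans; [apply Cmod_triangle|lra]. }
  destruct (mesh_bound N (2 * D * c ^ 2) _ hN ltac:(pose proof (pow2_ge_0 c); nra) Hb) as [_ B].
  specialize (B _ H2); rewrite Cmod_mult in B.
  assert (Rabs r <= 1)%R as hr.
  { unfold r; unfold Rdiv; rewrite Rabs_mult, (Rabs_pos_eq (/ INR N)) by (unfold c in *; lra).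
    apply Rmult_le_reg_r with (INR N); [lra|].
    rewrite Rmult_assoc, Rinv_l, Rmult_1_r, Rmult_1_l by lra.
    rewrite <- mult_IZR, <- abs_IZR, INR_IZR_INZ; apply IZR_le; lia. }
  pose proof (Cmod_E_add_E_opp_ge r hr) as hge.
  assert (r ^ 2 / 4 * Cmod G <= 4 * (2 * D * c ^ 2) * INR N)%R as hfin.
  { eapply Rle_trans; [|exact B]; apply Rmult_le_compat_r; [apply Cmod_ge_0|exact hge]. }
  apply Rmult_le_reg_r with (c ^ 2)%R; [apply pow_lt, hc0|].
  replace (r ^ 2 / 4)%R with (IZR k ^ 2 * c ^ 2)%R in hfin by (unfold r, c; field; lra).
  lra.
Qed.

(** Orthogonality of the characters, by a telescoping geometric sum. The range
    of frequencies is centred at zero, since the Fourier coefficients decay only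
    up to half of the mesh frequency. *)
Lemma root_of_unity_sum (M : nat) (j : Z) : (1 <= M)%nat ->
  lsum (fun k => E (2 * IZR k * (IZR j / INR (2 * M))%R))
    (map (fun i => (Z.of_nat i - Z.of_nat M)%Z) (seq 0 (2 * M)))
  = if (j mod Z.of_nat (2 * M) =? 0)%Z then RtoC (INR (2 * M)) else 0.
Proof.
  intros hM; set (N := (2 * M)%nat); rewrite lsum_map.
  assert (1 <= INR N)%R as hN1 by (apply (le_INR 1); lia).
  assert (RtoC (INR N) <> 0) as hN0 by (intros h; apply RtoC_inj in h; lra).
  set (r := (IZR j / INR N)%R).
  destruct (Z.eqb_spec (j mod Z.of_nat N) 0) as [h|h].
  - apply Z.mod_divide in h as [q hq]; [|lia].
    assert (r = IZR q) as hr
      by (unfold r; rewrite hq, mult_IZR, <- INR_IZR_INZ; field; lra).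
    transitivity (lsum (fun _ : nat => RtoC 1) (seq 0 N)).
    + apply lsum_ext_in; intros i _; rewrite hr.
      rewrite <- Cmult_assoc, <- RtoC_mult, <- mult_IZR; apply E_2Z.
    + clear; induction N as [|N IH]; [easy|].
      rewrite seq_S, lsum_app, IH, S_INR, RtoC_plus; simpl; ring.
  - set (a := E (2 * r)).
    assert (a <> 1) as ha.
    { (* the fractional part of [r] lies strictly between 0 and 1, where
         [sin (PI * x)] does not vanish *)
      intros h1.
      assert (exists s, (0 < s < 1)%R /\ a = E (2 * s)) as [s [hs has]].
      { exists (IZR (j mod Z.of_nat N) / INR N)%R.
        pose proof (Z.mod_pos_bound j (Z.of_nat N) ltac:(lia)) as [b1 b2].
        assert (0 < IZR (j mod Z.of_nat N))%R as c1 by (apply IZR_lt; lia).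
        assert (IZR (j mod Z.of_nat N) < INR N)%R as c2
          by (rewrite INR_IZR_INZ; apply IZR_lt, b2).
        split; [split|].
        - apply Rdiv_lt_0_compat; lra.
        - apply Rmult_lt_reg_r with (INR N); [lra|]; unfold Rdiv.
          rewrite Rmult_assoc, Rinv_l; lra.
        - unfold a; rewrite <- (E_plus_2Z (2 * (IZR (j mod Z.of_nat N) / INR N)%R) (j / Z.of_nat N)).
          f_equal.
          rewrite <- !RtoC_mult, <- RtoC_plus; f_equal; unfold r.
          pose proof (Z.div_mod j (Z.of_nat N) ltac:(lia)) as hdm.
          apply (f_equal IZR) in hdm; rewrite plus_IZR, mult_IZR, <- INR_IZR_INZ in hdm.
          rewrite hdm; field; lra. }
      rewrite has in h1; replace (2 * s) with (s + s) in h1 by ring.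
      rewrite E_plus, E_real in h1.
      apply (f_equal Re) in h1; simpl in h1.
      pose proof (sin2_cos2 (PI * s)) as h2; unfold Rsqr in h2.
      pose proof PI_RGT_0.
      pose proof (sin_gt_0 (PI * s) ltac:(nra) ltac:(nra)) as h3; nra. }
    set (T := lsum _ _).
    assert (forall n, (a - 1) * lsum (fun i : nat => E (2 * IZR (Z.of_nat i - Z.of_nat M) * r))
       (seq 0 n) = E (2 * IZR (Z.of_nat n - Z.of_nat M) * r) - E (2 * IZR (- Z.of_nat M) * r)) as K.
    { induction n as [|n IH]; [simpl; ring|].
      rewrite seq_S, lsum_app, Cmult_plus_distr_l, IH, Nat.add_0_l; simpl lsum.
      replace (2 * IZR (Z.of_nat (S n) - Z.of_nat M) * r)
        with (2 * IZR (Z.of_nat n - Z.of_nat M) * r + 2 * r).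
      - rewrite E_plus; fold a; ring.
      - replace (Z.of_nat (S n) - Z.of_nat M)%Z with (Z.of_nat n - Z.of_nat M + 1)%Z by lia.
        rewrite plus_IZR, RtoC_plus; ring. }
    assert ((a - 1) * T = 0) as HS.
    { unfold T; rewrite K.
      replace (2 * IZR (Z.of_nat N - Z.of_nat M) * r)
        with (2 * IZR (- Z.of_nat M) * r + 2 * IZR j).
      - rewrite E_plus_2Z; ring.
      - replace (Z.of_nat N - Z.of_nat M)%Z with (- Z.of_nat M + Z.of_nat N)%Z by lia.
        rewrite plus_IZR, RtoC_plus, <- INR_2_Z; unfold r.
        rewrite RtoC_div by lra; field; exact hN0. }
    destruct (Ceq_dec T 0) as [e0|n0]; [exact e0|exfalso].
    apply (Cmult_neq_0 (a - 1) T); try assumption.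
    intros h1; apply ha, Ceq_minus, h1.
Qed.

(** Finite Fourier inversion on the mesh of [2 M] points per unit, evaluated
    at the mesh point [p / (2 M)]. *)
Lemma gfourier_inversion (t a : C) (M : nat) (p : Z) : (0 < Im t)%R -> (1 <= M)%nat ->
  RtoC (IZR p / INR (2 * M)) = a ->
  lsum (fun k => gfourier t (2 * M) k * E (2 * IZR k * a))
    (map (fun i => (Z.of_nat i - Z.of_nat M)%Z) (seq 0 (2 * M)))
  = INR (2 * M) * Theta a 0 t.
Proof.
  intros ht hM ha; set (N := (2 * M)%nat) in *; set (l := map _ _).
  assert (1 <= N)%nat as hN by lia.
  assert (1 <= INR N)%R as hN1 by (apply (le_INR 1); lia).
  assert (RtoC (INR N) <> 0) as hN0 by (intros h; apply RtoC_inj in h; lra).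
  set (f := fun m : Z => E (t * (IZR m / INR N)%R ^ 2)
     * (if ((p - m) mod Z.of_nat N =? 0)%Z then RtoC (INR N) else 0)).
  assert (has_sum f (lsum (fun k => gfourier t N k * E (2 * IZR k * a)) l)) as Hf.
  { eapply has_sum_ext; [|apply (has_sum_lsum (fun k m => E (2 * IZR k * a)
       * (E (t * (IZR m / INR N)%R ^ 2) * E (- (2 * IZR k * (IZR m / INR N)%R))))
       (fun k => gfourier t N k * E (2 * IZR k * a)))].
    - intros m; unfold f, N; rewrite <- root_of_unity_sum by exact hM; fold N.
      rewrite <- lsum_scal; apply lsum_ext_in; intros k _.
      rewrite <- !E_plus; f_equal; rewrite <- ha.
      rewrite minus_IZR; unfold Rdiv; rewrite Rmult_minus_distr_r, RtoC_minus; ring.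
    - intros k _; rewrite (Cmult_comm (gfourier _ _ _)); apply has_sum_scal, gfourier_has_sum; assumption. }
  apply (has_sum_inj (fun n => (p + n * Z.of_nat N)%Z)) in Hf.
  - apply (has_sum_unique _ _ _ Hf).
    eapply has_sum_ext; [|apply (has_sum_scal (INR N)), Theta_has_sum, ht].
    intros n; unfold f; cbv beta.
    replace ((p - (p + n * Z.of_nat N)) mod Z.of_nat N)%Z with 0%Z.
    + rewrite Z.eqb_refl, Cmult_comm; f_equal; f_equal.
      replace (IZR (p + n * Z.of_nat N) / INR N)%R with (IZR n + IZR p / INR N)%R
        by (rewrite plus_IZR, mult_IZR, <- INR_IZR_INZ; field; lra).
      rewrite RtoC_plus, ha; ring.
    + replace (p - (p + n * Z.of_nat N))%Z with (- n * Z.of_nat N)%Z by lia.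
      symmetry; apply Z.mod_mul; lia.
  - intros i j h; nia.
  - intros m; unfold f; destruct (Z.eqb_spec ((p - m) mod Z.of_nat N) 0) as [h|h].
    + left; apply Z.mod_divide in h as [q hq]; [|lia]; exists (- q)%Z; lia.
    + right; ring.
Qed.

Lemma summable_inv_sq : summable (fun k : Z => RtoC (/ (1 + IZR k ^ 2))).
Proof.
  assert (summable (fun n : nat => RtoC (/ (1 + INR n ^ 2)))) as K.
  { apply summable_nat with 6%R; intros n.
    enough (lsumR (fun i => Cmod (/ (1 + INR i ^ 2))%R) (seq 0 n) <= 6 - 6 / (INR n + 1))%R as h.
    { pose proof (pos_INR n).
      assert (0 < 6 / (INR n + 1))%R by (apply Rdiv_lt_0_compat; lra); lra. }
    induction n as [|n IH]; [simpl; lra|].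
    rewrite seq_S, lsumR_app, Nat.add_0_l; set (q := lsumR _ (seq 0 n)) in *.
    unfold lsumR; cbn [fold_right].
    rewrite S_INR; pose proof (pos_INR n); set (x := INR n) in *.
    rewrite Cmod_R, Rabs_pos_eq by (left; apply Rinv_0_lt_compat; nra).
    assert (6 / (x + 1) - 6 / (x + 1 + 1) - / (1 + x ^ 2)
       = (5 * x ^ 2 - 3 * x + 4) / ((x + 1) * (x + 1 + 1) * (1 + x ^ 2)))%R as h by (field; nra).
    assert (0 <= (5 * x ^ 2 - 3 * x + 4) / ((x + 1) * (x + 1 + 1) * (1 + x ^ 2)))%R.
    { apply Rdiv_le_0_compat; [nra|]; repeat apply Rmult_lt_0_compat; nra. }
    lra. }
  apply summable_Z; (eapply summable_le; [exact K|]); intros n; cbv beta.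
  - rewrite <- INR_IZR_INZ; lra.
  - rewrite opp_IZR, <- INR_IZR_INZ; replace ((- INR n) ^ 2)%R with (INR n ^ 2)%R by ring; lra.
Qed.

Lemma Im_neg_inv (t : C) : (0 < Im t)%R -> (0 < Im (- (1) / t))%R.
Proof.
  destruct t as [x y]; simpl; intros h.
  assert (0 < x * (x * 1) + y * (y * 1))%R as h1 by nra.
  replace (_ + _)%R with (y / (x * (x * 1) + y * (y * 1)))%R by (field; lra).
  apply Rdiv_lt_0_compat; assumption.
Qed.

(** Poisson summation up to the Gaussian integral, of which only the Riemann
    sums with mesh [1 / (2 n + 2)] appear. *)
Lemma theta_poisson (t a : C) : (0 < Im t)%R -> a = 0 \/ a = 1 / 2 ->
  Clim (fun n => Theta a 0 t - gsum t (2 * S n) 0 / INR (2 * S n) * Theta 0 a (- (1) / t)) 0.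
Proof.
  intros ht ha; pose proof (Im_neg_inv t ht) as ht'; pose proof (Im_pos_neq_0 t ht) as ht0.
  set (N := fun n => (2 * S n)%nat); set (h := fun n => gsum t (N n) 0 / INR (N n)).
  assert (forall n, (1 <= INR (N n))%R) as hN by (intros n; apply (le_INR 1); unfold N; lia).
  assert (forall n, RtoC (INR (N n)) <> 0) as hN0
    by (intros n hh; apply RtoC_inj in hh; specialize (hN n); lra).
  assert (exists r : R, a = r) as [ra hra].
  { destruct ha as [->| ->]; [exists 0%R; easy|exists (1 / 2)%R].
    rewrite RtoC_div by lra; easy. }
  assert (forall k, Cmod (E (2 * IZR k * a)) = 1%R) as hmod.
  { intros k; rewrite hra, <- !RtoC_mult, Cmod_E; simpl; rewrite Rmult_0_r; apply exp_0. }
  set (inr := fun n k => andb (- Z.of_nat (S n) <=? k)%Z (k <? Z.of_nat (S n))%Z).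
  (* the terms of the finite inversion formula, extended by zero *)
  set (F := fun n (k : Z) => if inr n k then gfourier t (N n) k / INR (N n) * E (2 * IZR k * a)
                             else RtoC 0).
  set (Q := fun k : Z => E (- (1) / t * (IZR k + 0) ^ 2 + 2 * (IZR k + 0) * a)).
  assert (forall n, has_sum (F n) (Theta a 0 t)) as HF.
  { intros n; assert (Theta a 0 t = lsum (F n)
      (map (fun i => (Z.of_nat i - Z.of_nat (S n))%Z) (seq 0 (2 * S n)))) as ->.
    { transitivity (/ INR (N n) * (INR (N n) * Theta a 0 t)); [field; apply hN0|].
      assert (exists p : Z, RtoC (IZR p / INR (2 * S n)) = a) as [p hp].
      { destruct ha as [->| ->].
        - exists 0%Z; f_equal; unfold Rdiv; ring.
        - exists (Z.of_nat (S n)); rewrite <- INR_IZR_INZ, mult_INR.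
          rewrite <- RtoC_div by lra; f_equal; change (INR 2) with 2%R; field.
          rewrite S_INR; pose proof (pos_INR n); lra. }
      unfold N at 2; rewrite <- (gfourier_inversion t a (S n) p) by (assumption || lia).
      rewrite <- lsum_scal; apply lsum_ext_in; intros k hk.
      apply in_map_iff in hk as [i [<- hi]]; apply in_seq in hi.
      unfold F, inr; destruct (Z.leb_spec (- Z.of_nat (S n)) (Z.of_nat i - Z.of_nat (S n))); [|lia].
      destruct (Z.ltb_spec (Z.of_nat i - Z.of_nat (S n)) (Z.of_nat (S n))); [|lia].
      simpl andb; cbv iota; fold (N n); field; apply hN0. }
    apply has_sum_finite.
    - apply NoDup_map_inj; [intros i j; lia|apply seq_NoDup].
    - intros k hk; unfold F, inr.
      destruct (Z.leb_spec (- Z.of_nat (S n)) k); [|easy].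
      destruct (Z.ltb_spec k (Z.of_nat (S n))); [|easy].
      exfalso; apply hk, in_map_iff; exists (Z.to_nat (k + Z.of_nat (S n))).
      split; [lia|apply in_seq; lia]. }
  assert (has_sum Q (Theta 0 a (- (1) / t))) as HQ by (apply Theta_has_sum, ht').
  assert (exists B, forall n, (Cmod (h n) <= B)%R) as [B HB].
  { destruct (gauss_bound t 0 1 ht) as [B [hB HB]]; [lra|lra|].
    exists (4 * B)%R; intros n; unfold h.
    rewrite Cmod_div by apply hN0; rewrite Cmod_R, Rabs_pos_eq by (specialize (hN n); lra).
    specialize (hN n); apply Rmult_le_reg_r with (INR (N n)); [lra|].
    unfold Rdiv; rewrite Rmult_assoc, Rinv_l, Rmult_1_r by lra.
    assert (1 <= N n)%nat as hNn by (unfold N; lia).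
    destruct (mesh_bound (N n) B (fun m : Z => E (t * ((IZR m / INR (N n))%R + 0) ^ 2)) hNn)
      as [_ K]; [lra| |].
    - intros m; eapply Rle_trans; [apply HB; rewrite Cmod_0; lra|].
      apply Req_le; do 2 f_equal; ring.
    - apply K, gsum_has_sum; assumption. }
  assert (0 <= B)%R as hB0 by (eapply Rle_trans; [apply Cmod_ge_0|apply (HB 0%nat)]).
  destruct (gfourier_decay t ht) as [D [hD HD]].
  assert (forall n k, gfourier t (N n) k / INR (N n) * E (2 * IZR k * a)
     = Q k * (gsum t (N n) (- (IZR k / t)) / INR (N n))) as HFQ.
  { intros n k; unfold gfourier, Q.
    replace (- (1) / t * (IZR k + 0) ^ 2 + 2 * (IZR k + 0) * a)
      with (- (IZR k ^ 2 / t) + 2 * IZR k * a) by (field; exact ht0).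
    rewrite E_plus; unfold Cdiv; ring. }
  apply (Tannery (fun n k => F n k + - h n * Q k) (fun _ => 0)
    (fun k => RtoC (2 * (D + B)) * RtoC (/ (1 + IZR k ^ 2)) + B * RtoC (Cmod (Q k)))).
  - apply summable_plus; apply summable_scal; [apply summable_inv_sq|].
    apply summable_le with Q; [apply HQ|]; intros k; rewrite Cmod_R, Rabs_pos_eq; [lra|].
    apply Cmod_ge_0.
  - intros n k; pose proof (Cmod_ge_0 (Q k)).
    assert (0 < 1 + IZR k ^ 2)%R as hk0 by (pose proof (pow2_ge_0 (IZR k)); lra).
    pose proof (Rinv_0_lt_compat _ hk0) as hk1.
    rewrite <- !RtoC_mult, <- RtoC_plus, Cmod_R, Rabs_pos_eq
      by (apply Rplus_le_le_0_compat; apply Rmult_le_pos; lra).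
    eapply Rle_trans; [apply Cmod_triangle|]; apply Rplus_le_compat.
    + unfold F; destruct (inr n k) eqn:hin;
        [|rewrite Cmod_0; apply Rmult_le_pos; lra].
      unfold inr in hin; apply andb_prop in hin as [hin1 hin2].
      apply Z.leb_le in hin1; apply Z.ltb_lt in hin2.
      rewrite Cmod_mult, hmod, Rmult_1_r.
      apply Rmult_le_reg_r with (1 + IZR k ^ 2)%R; [exact hk0|].
      rewrite Rmult_assoc, Rinv_l, Rmult_1_r by lra.
      destruct (Z.eq_dec k 0) as [->|hkn].
      * (* at frequency zero only the boundedness of the Riemann sums helps *)
        unfold gfourier; replace (- (IZR 0 ^ 2 / t)) with (RtoC 0) by (field; exact ht0).
        replace (- (IZR 0 / t)) with (RtoC 0) by (field; exact ht0).
        rewrite E_0, Cmult_1_l; fold (h n); specialize (HB n); simpl; lra.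
      * assert (1 <= IZR k ^ 2)%R as hk2.
        { simpl; rewrite Rmult_1_r, <- mult_IZR; apply IZR_le; nia. }
        rewrite Cmod_div by apply hN0; rewrite Cmod_R, Rabs_pos_eq by (specialize (hN n); lra).
        specialize (HD (N n) k ltac:(unfold N; lia) ltac:(unfold N; lia)).
        pose proof (Cmod_ge_0 (gfourier t (N n) k)); specialize (hN n).
        apply Rmult_le_reg_r with (INR (N n)); [lra|].
        replace (Cmod (gfourier t (N n) k) / INR (N n) * (1 + IZR k ^ 2) * INR (N n))%R
          with (Cmod (gfourier t (N n) k) * (1 + IZR k ^ 2))%R by (field; lra).
        assert (0 <= B * INR (N n))%R by (apply Rmult_le_pos; lra).
        assert (Cmod (gfourier t (N n) k) * 1 <= Cmod (gfourier t (N n) k) * IZR k ^ 2)%R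
          by (apply Rmult_le_compat_l; assumption).
        lra.
    + rewrite Cmod_mult, Cmod_opp; apply Rmult_le_compat_r; [assumption|apply HB].
  - intros k; destruct (gsum_translation_limit t (- (IZR k / t)) ht) as [A [hA HA]].
    intros e he.
    destruct (nfloor_ex (Cmod (- (IZR k / t)))) as [n1 hn1]; [apply Cmod_ge_0|].
    pose proof (Cmod_ge_0 (Q k)) as hq.
    destruct (nfloor_ex ((Cmod (Q k) + 1) * A / e)) as [n2 hn2].
    { apply Rdiv_le_0_compat; [apply Rmult_le_pos; lra|exact he]. }
    exists (Z.abs_nat k + n1 + n2)%nat; intros n hn; unfold F.
    assert (inr n k = true) as ->.
    { unfold inr; apply andb_true_intro; split; [apply Z.leb_le|apply Z.ltb_lt]; lia. }
    rewrite HFQ; unfold h.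
    replace (Q k * (gsum t (N n) (- (IZR k / t)) / INR (N n))
       + - (gsum t (N n) 0 / INR (N n)) * Q k - 0)
      with (Q k * ((gsum t (N n) (- (IZR k / t)) - gsum t (N n) 0) / INR (N n)))
      by (unfold Cdiv; ring).
    assert (INR n1 + 1 <= INR (N n))%R as b1
      by (rewrite <- S_INR; apply le_INR; unfold N; lia).
    assert (INR n2 + 1 <= INR (N n))%R as b2
      by (rewrite <- S_INR; apply le_INR; unfold N; lia).
    specialize (HA (N n) ltac:(unfold N; lia) ltac:(lra)); specialize (hN n).
    rewrite Cmod_mult, Cmod_div by apply hN0.
    rewrite Cmod_R, (Rabs_pos_eq (INR (N n))) by lra.
    apply Rmult_lt_reg_r with (INR (N n)); [lra|].
    match goal with |- (_ * (?X / _) * _ < _)%R =>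
      replace (Cmod (Q k) * (X / INR (N n)) * INR (N n))%R with (Cmod (Q k) * X)%R by (field; lra)
    end.
    apply Rle_lt_trans with ((Cmod (Q k) + 1) * A)%R.
    + apply Rmult_le_compat; try apply Cmod_ge_0; lra.
    + apply Rmult_lt_reg_r with (/ e)%R; [apply Rinv_0_lt_compat, he|].
      replace (e * INR (N n) * / e)%R with (INR (N n)) by (field; lra).
      unfold Rdiv in hn2; lra.
  - intros n; apply has_sum_plus; [apply HF|].
    replace (- (gsum t (2 * S n) 0 / INR (2 * S n) * Theta 0 a (- (1) / t)))
      with (- h n * Theta 0 a (- (1) / t)) by (unfold h, N; ring).
    apply has_sum_scal, HQ.
  - apply (has_sum_finite (fun _ : Z => RtoC 0) nil); [constructor|easy].
Qed.

(** The common factor of both instances of the Poisson formula is eliminated. *)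
Lemma theta_inversion (t : C) : (0 < Im t)%R ->
  Theta 0 0 t * Theta 0 (1 / 2) (- (1) / t) = Theta (1 / 2) 0 t * Theta 0 0 (- (1) / t).
Proof.
  intros ht; apply Ceq_minus.
  pose proof (theta_poisson t 0 ht (or_introl eq_refl)) as H0.
  pose proof (theta_poisson t (1 / 2) ht (or_intror eq_refl)) as H1.
  apply Clim_unique with (fun n : nat => Theta 0 0 t * Theta 0 (1 / 2) (- (1) / t)
    - Theta (1 / 2) 0 t * Theta 0 0 (- (1) / t)); [apply Clim_const|].
  pose proof (Clim_minus _ _ _ _
    (Clim_mult _ _ _ _ H0 (Clim_const (Theta 0 (1 / 2) (- (1) / t))))
    (Clim_mult _ _ _ _ H1 (Clim_const (Theta 0 0 (- (1) / t))))) as H.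
  replace (0 * Theta 0 (1 / 2) (- (1) / t) - 0 * Theta 0 0 (- (1) / t)) with (RtoC 0) in H by ring.
  eapply Clim_ext; [|exact H]; intros n; cbv beta; ring.
Qed.

(** * Infinite products and the triple product identity *)

Lemma Cprod_n_ext (f g : nat -> C) (n : nat) :
  (forall i, f i = g i) -> Cprod_n f n = Cprod_n g n.
Proof. intros H; induction n as [|n IH]; simpl; [easy|rewrite IH, H; easy]. Qed.

Lemma Cprod_n_S (f : nat -> C) (n : nat) : Cprod_n f (S n) = Cprod_n f n * f n.
Proof. easy. Qed.

Lemma Cprod_n_mul (f g : nat -> C) (n : nat) :
  Cprod_n (fun i => f i * g i) n = Cprod_n f n * Cprod_n g n.
Proof. induction n as [|n IH]; simpl; [ring|rewrite IH; ring]. Qed.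

Lemma Cprod_n_add (f : nat -> C) (n m : nat) :
  Cprod_n f (n + m) = Cprod_n f n * Cprod_n (fun i => f (n + i)%nat) m.
Proof.
  induction m as [|m IH]; [rewrite Nat.add_0_r; simpl; ring|].
  rewrite Nat.add_succ_r; simpl; rewrite IH; ring.
Qed.

Lemma Cprod_n_head (f : nat -> C) (n : nat) :
  Cprod_n f (S n) = f 0%nat * Cprod_n (fun i => f (S i)) n.
Proof. change (S n) with (1 + n)%nat; rewrite Cprod_n_add; simpl; ring. Qed.

Lemma Clim_shift (u : nat -> C) (l : C) : Clim (fun n => u (S n)) l -> Clim u l.
Proof.
  intros H e he; destruct (H e he) as [N HN]; exists (S N); intros n hn.
  destruct n as [|n]; [lia|]; apply HN; lia.
Qed.

Lemma Cprod_n_bounded (x : nat -> C) (c r : R) :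
  (0 <= c)%R -> (0 <= r < 1)%R -> (forall i, (Cmod (x i) <= c * r ^ i)%R) ->
  forall n, (Cmod (Cprod_n (fun i => 1 + x i)%C n) <= exp (c * / (1 - r)))%R.
Proof.
  intros hc hr hx n.
  apply Rle_trans with (exp (lsumR (fun i => c * r ^ i)%R (seq 0 n))).
  - induction n as [|n IH]; [simpl; rewrite Cmod_1, exp_0; lra|].
    rewrite seq_S, lsumR_app, exp_plus, Nat.add_0_l; simpl Cprod_n; rewrite Cmod_mult.
    apply Rmult_le_compat; try apply Cmod_ge_0; [exact IH|].
    eapply Rle_trans; [apply Cmod_triangle|]; rewrite Cmod_1.
    eapply Rle_trans; [apply Rplus_le_compat_l, hx|].
    eapply Rle_trans; [apply exp_ineq1_le|]; apply Req_le; f_equal; simpl; ring.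
  - apply exp_le; rewrite lsumR_scal; apply Rmult_le_compat_l; [exact hc|].
    apply lsumR_geom, hr.
Qed.

(** The product of the inverses has the same shape, hence is bounded too:
    this keeps the partial products away from zero. *)
Lemma Cprod_n_limit (x : nat -> C) (r : R) :
  (0 <= r < 1)%R -> (forall i, (Cmod (x i) <= r ^ S i)%R) ->
  exists l : C, l <> 0 /\ Clim (Cprod_n (fun i => 1 + x i)) l.
Proof.
  intros hr hx; set (P := Cprod_n (fun i => 1 + x i)).
  assert (forall i, (Cmod (x i) <= r * r ^ i)%R) as hx1 by (intros i; apply hx).
  assert (forall i, (Cmod (x i) <= r)%R) as hxr.
  { intros i; eapply Rle_trans; [apply hx1|].
    rewrite <- (Rmult_1_r r) at 3; apply Rmult_le_compat_l; [lra|].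
    rewrite <- (pow1 i); apply pow_incr; lra. }
  pose proof (Cprod_n_bounded x r r ltac:(lra) hr hx1) as hB; fold P in hB.
  set (K := exp (r * / (1 - r))) in *.
  pose proof (exp_pos (r * / (1 - r))) as hK; fold K in hK.
  assert (summable (fun n => P n * x n)) as Hs.
  { apply summable_nat with (K * r * / (1 - r))%R; intros n.
    apply Rle_trans with (lsumR (fun i => K * r * r ^ i)%R (seq 0 n)).
    - apply lsumR_le; intros i _; rewrite Cmod_mult, Rmult_assoc.
      apply Rmult_le_compat; try apply Cmod_ge_0; auto.
    - rewrite lsumR_scal; apply Rmult_le_compat_l;
        [apply Rmult_le_pos; lra|apply lsumR_geom, hr]. }
  apply summable_has_sum in Hs; set (s := tsum _) in *.
  assert (Clim P (1 + s)) as HP.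
  { apply Clim_shift; apply Clim_ext with (fun n => 1 + sum_n (fun n => P n * x n) n).
    - intros n; rewrite sum_n_lsum; induction n as [|n IH]; [unfold P; simpl; ring|].
      rewrite seq_S, lsum_app, Nat.add_0_l, Cplus_assoc, IH; unfold P; simpl; ring.
    - apply Clim_plus; [apply Clim_const|apply has_sum_nat_Clim, Hs]. }
  exists (1 + s); split; [|exact HP].
  assert (forall i, 1 + x i <> 0) as hn0.
  { intros i h; specialize (hxr i).
    assert (x i = - (1)) as h1 by (replace (x i) with (1 + x i - 1) by ring; rewrite h; ring).
    rewrite h1, Cmod_m1 in hxr; lra. }
  set (y := fun i => - x i / (1 + x i)).
  assert (forall i, (Cmod (y i) <= r / (1 - r) * r ^ i)%R) as hy.
  { intros i; unfold y; rewrite Cmod_div, Cmod_opp by apply hn0.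
    assert (1 - r <= Cmod (1 + x i))%R as h1.
    { pose proof (Cmod_triangle (1 + x i) (- x i)) as T.
      replace (1 + x i + - x i) with (RtoC 1) in T by ring.
      rewrite Cmod_1, Cmod_opp in T; specialize (hxr i); lra. }
    replace (r / (1 - r) * r ^ i)%R with (r * r ^ i * / (1 - r))%R by (unfold Rdiv; ring).
    apply Rmult_le_compat; [apply Cmod_ge_0| |apply hx1|apply Rinv_le_contravar; lra].
    left; apply Rinv_0_lt_compat; lra. }
  assert (0 <= r / (1 - r))%R as hc by (apply Rdiv_le_0_compat; lra).
  pose proof (Cprod_n_bounded y (r / (1 - r)) r hc hr hy) as hB'.
  set (K' := exp (r / (1 - r) * / (1 - r))) in *.
  pose proof (exp_pos (r / (1 - r) * / (1 - r))) as hK'; fold K' in hK'.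
  assert (/ K' <= Cmod (1 + s))%R as hge.
  { apply Clim_ge with P; [exact HP|]; intros n.
    assert (P n * Cprod_n (fun i => 1 + y i) n = 1) as h1.
    { unfold P; rewrite <- Cprod_n_mul.
      transitivity (Cprod_n (fun _ => 1) n).
      - apply Cprod_n_ext; intros i; unfold y; field; apply hn0.
      - clear; induction n as [|n IH]; simpl; [easy|rewrite IH; ring]. }
    apply (f_equal Cmod) in h1; rewrite Cmod_mult, Cmod_1 in h1.
    specialize (hB' n); pose proof (Cmod_ge_0 (P n)).
    apply Rmult_le_reg_r with K'; [exact hK'|]; rewrite Rinv_l by lra.
    rewrite <- h1; apply Rmult_le_compat_l; assumption. }
  pose proof (Rinv_0_lt_compat _ hK').
  intros h; rewrite h, Cmod_0 in hge; lra.
Qed.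

Lemma E_pow (x : C) (n : nat) : E x ^ n = E (INR n * x).
Proof.
  induction n as [|n IH]; [simpl; rewrite Cmult_0_l, E_0; easy|].
  rewrite Cpow_S, IH, <- E_plus, S_INR, RtoC_plus; f_equal; ring.
Qed.

Lemma Cmod_E_lt_1 (t : C) : (0 < Im t)%R -> (0 <= Cmod (E t) < 1)%R.
Proof.
  intros ht; split; [apply Cmod_ge_0|].
  rewrite Cmod_E, <- exp_0; apply exp_increasing.
  pose proof PI_RGT_0; nra.
Qed.

(** The finite product [(q ; q)_n]. *)
Definition qfac (q : C) (n : nat) : C := Cprod_n (fun i => 1 - q * q ^ i) n.

Definition qbinom (q : C) (n k : nat) : C :=
  if (k <=? n)%nat then qfac q n / (qfac q k * qfac q (n - k)) else 0.

Lemma qfac_neq_0 (q : C) (n : nat) : (Cmod q < 1)%R -> qfac q n <> 0.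
Proof.
  intros hq; induction n as [|n IH]; [apply C1_nz|].
  apply Cmult_neq_0; [exact IH|]; intros h.
  assert (q ^ S n = 1) as h1
    by (rewrite Cpow_S; symmetry; apply Ceq_minus; exact h).
  apply (f_equal Cmod) in h1; rewrite Cmod_pow, Cmod_1 in h1.
  pose proof (pow_lt_1_compat (Cmod q) (S n) (conj (Cmod_ge_0 q) hq) ltac:(lia)); lra.
Qed.

Lemma qbinom_pascal (q : C) (n k : nat) : (Cmod q < 1)%R -> (k <= n)%nat ->
  qbinom q (S n) (S k) = qbinom q n (S k) + q ^ (n - k) * qbinom q n k.
Proof.
  intros hq hk; unfold qbinom.
  destruct (Nat.leb_spec (S k) (S n)); [|lia]; destruct (Nat.leb_spec k n); [|lia].
  pose proof (qfac_neq_0 q k hq) as h1; pose proof (qfac_neq_0 q (S k) hq) as h2.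
  pose proof (qfac_neq_0 q (n - k) hq) as h3.
  replace (S n - S k)%nat with (n - k)%nat by lia.
  change (qfac q (S n)) with (qfac q n * (1 - q * q ^ n)).
  change (qfac q (S k)) with (qfac q k * (1 - q * q ^ k)) in *.
  assert (1 - q * q ^ k <> 0) as h4 by (intros h4; apply h2; rewrite h4; ring).
  destruct (Nat.leb_spec (S k) n) as [h|h].
  - set (d := (n - S k)%nat); replace (n - k)%nat with (S d) in * by (unfold d; lia).
    assert (q ^ n = q ^ k * (q * q ^ d)) as ->
      by (rewrite <- Cpow_S, <- Cpow_add_r; f_equal; unfold d; lia).
    rewrite Cpow_S.
    change (qfac q (S d)) with (qfac q d * (1 - q * q ^ d)) in *.
    assert (1 - q * q ^ d <> 0) as h5 by (intros h5; apply h3; rewrite h5; ring).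
    assert (qfac q d <> 0) as h6 by (apply qfac_neq_0, hq).
    field; repeat split; assumption.
  - replace n with k by lia; rewrite Nat.sub_diag; change (qfac q 0) with (RtoC 1).
    change (q ^ 0) with (RtoC 1); field; repeat split; try assumption; apply C1_nz.
Qed.

(** Induction on [n] by Pascal's rule. Powers of [q = E rho] and [x = E u] are
    written as exponentials, so that negative exponents can be inserted later. *)
Lemma q_binomial_theorem (rho u : C) (n : nat) : (0 < Im rho)%R ->
  Cprod_n (fun i => 1 + E (u + INR i * rho)) n =
  lsum (fun k => qbinom (E rho) n k * E (rho * (INR k * (INR k - 1) / 2) + INR k * u))
    (seq 0 (S n)).
Proof.
  intros hr; pose proof (proj2 (Cmod_E_lt_1 rho hr)) as hq.
  set (e := fun k : nat => E (rho * (INR k * (INR k - 1) / 2) + INR k * u)).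
  assert (forall k, e (S k) = E (u + INR k * rho) * e k) as he.
  { intros k; unfold e; rewrite <- E_plus, S_INR, RtoC_plus; f_equal; field. }
  assert (e 0%nat = 1) as he0.
  { unfold e; simpl; rewrite <- E_0; f_equal; field. }
  assert (forall m, qbinom (E rho) m 0 = 1) as hb0.
  { intros m; unfold qbinom; simpl; rewrite Nat.sub_0_r; unfold qfac at 2; simpl.
    field; apply qfac_neq_0, hq. }
  change (Cprod_n (fun i => 1 + E (u + INR i * rho)) n =
    lsum (fun k => qbinom (E rho) n k * e k) (seq 0 (S n))).
  induction n as [|n IH].
  - simpl; rewrite he0, hb0; ring.
  - assert (forall m, seq 0 (S m) = 0%nat :: map S (seq 0 m)) as hseq
      by (intros m; simpl; rewrite seq_shift; easy).
    transitivity (lsum (fun k => qbinom (E rho) n k * e k) (seq 0 (S n))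
       + E (u + INR n * rho) * lsum (fun k => qbinom (E rho) n k * e k) (seq 0 (S n))).
    { simpl Cprod_n; rewrite IH; ring. }
    rewrite (hseq (S n)), lsum_cons, lsum_map, hb0.
    rewrite (lsum_ext_in (fun k => qbinom (E rho) (S n) (S k) * e (S k))
      (fun k => qbinom (E rho) n (S k) * e (S k)
      + E (u + INR n * rho) * (qbinom (E rho) n k * e k)) (seq 0 (S n))).
    + rewrite lsum_plus, lsum_scal, Cplus_assoc; f_equal.
      rewrite <- (lsum_map S (fun k => qbinom (E rho) n k * e k)).
      transitivity (lsum (fun k => qbinom (E rho) n k * e k) (seq 0 (S (S n)))).
      * rewrite (seq_S (S n)), lsum_app, Nat.add_0_l.
        assert (qbinom (E rho) n (S n) = 0) as hb
          by (unfold qbinom; destruct (Nat.leb_spec (S n) n); [lia|easy]).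
        rewrite lsum_one, hb; ring.
      * rewrite (hseq (S n)); rewrite lsum_cons, hb0; easy.
    + intros k hk; apply in_seq in hk.
      rewrite qbinom_pascal by (assumption || lia).
      rewrite he, E_pow, minus_INR, RtoC_minus by lia.
      assert (E (u + INR n * rho) = E ((INR n - INR k) * rho) * E (u + INR k * rho)) as ->
        by (rewrite <- E_plus; f_equal; ring).
      ring.
Qed.

(** The factors with negative powers of [q] are turned around; the product of
    what is taken out is the normalising factor of the triple product. *)
Lemma half_product_reverse (rho u : C) (n : nat) :
  Cprod_n (fun i => 1 + E (u - INR n * rho + INR i * rho)) n
  = E (INR n * u - rho * (INR n * (INR n + 1) / 2))
    * Cprod_n (fun i => 1 + E ((INR i + 1) * rho - u)) n.
Proof.
  induction n as [|n IH].
  - simpl; replace (0 * u - rho * (0 * (0 + 1) / 2)) with (RtoC 0) by field.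
    rewrite E_0; ring.
  - rewrite Cprod_n_head.
    rewrite (Cprod_n_ext _ (fun i => 1 + E (u - INR n * rho + INR i * rho))).
    + rewrite IH; simpl Cprod_n; rewrite S_INR, RtoC_plus; simpl (INR 0).
      replace (u - (INR n + 1) * rho + 0 * rho) with (u - (INR n + 1) * rho) by ring.
      replace ((INR n + 1) * u - rho * ((INR n + 1) * (INR n + 1 + 1) / 2))
        with ((INR n * u - rho * (INR n * (INR n + 1) / 2)) + (u - (INR n + 1) * rho)) by field.
      rewrite E_plus; set (v := u - (INR n + 1) * rho).
      replace ((INR n + 1) * rho - u) with (- v) by (unfold v; ring).
      rewrite E_opp; field; apply E_neq_0.
    + intros i; rewrite !S_INR, !RtoC_plus; do 2 f_equal; ring.
Qed.

(** The [q]-binomial theorem for [2 n] factors, started at the power [- n]. *)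
Lemma finite_triple_product (rho u : C) (n : nat) : (0 < Im rho)%R ->
  Cprod_n (fun i => 1 + E (u + INR i * rho)) n
    * Cprod_n (fun i => 1 + E ((INR i + 1) * rho - u)) n
  = lsum (fun k => qbinom (E rho) (2 * n) k
       * E (rho * ((INR k - INR n) * (INR k - INR n - 1) / 2) + (INR k - INR n) * u))
      (seq 0 (S (2 * n))).
Proof.
  intros hr.
  pose proof (q_binomial_theorem rho (u - INR n * rho) (2 * n) hr) as H.
  replace (2 * n)%nat with (n + n)%nat in H at 1 by lia.
  rewrite Cprod_n_add, half_product_reverse in H.
  rewrite (Cprod_n_ext (fun i => 1 + E (u - INR n * rho + INR (n + i) * rho))
    (fun i => 1 + E (u + INR i * rho))) in H
    by (intros i; rewrite plus_INR, RtoC_plus; do 2 f_equal; ring).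
  set (c := INR n * u - rho * (INR n * (INR n + 1) / 2)) in *.
  set (X := Cprod_n (fun i => 1 + E (u + INR i * rho)) n) in *.
  set (Y := Cprod_n (fun i => 1 + E ((INR i + 1) * rho - u)) n) in *.
  transitivity (E (- c) * (E c * Y * X)); [rewrite E_opp; field; apply E_neq_0|].
  rewrite H, <- lsum_scal; apply lsum_ext_in; intros k _.
  rewrite Cmult_assoc, (Cmult_comm (E (- c))), <- Cmult_assoc, <- E_plus.
  f_equal; f_equal; unfold c; field.
Qed.

(** Jacobi's triple product, from the finite identity by dominated
    convergence: the [q]-binomial coefficients are bounded and tend to
    [1 / (q ; q)]. *)
Lemma triple_product (rho u A B Q : C) : (0 < Im rho)%R -> Q <> 0 ->
  Clim (Cprod_n (fun i => 1 + E (u + INR i * rho))) A ->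
  Clim (Cprod_n (fun i => 1 + E ((INR i + 1) * rho - u))) B ->
  Clim (qfac (E rho)) Q ->
  has_sum (fun j : Z => E (rho * (IZR j * (IZR j - 1) / 2) + IZR j * u)) (Q * (A * B)).
Proof.
  intros hr hQ0 HA HB HQ; pose proof (proj2 (Cmod_E_lt_1 rho hr)) as hq.
  set (q := E rho) in *.
  set (e := fun j : Z => E (rho * (IZR j * (IZR j - 1) / 2) + IZR j * u)).
  assert (has_sum e (tsum e)) as He.
  { apply summable_has_sum.
    assert (0 < Im (rho / 2))%R as hr2.
    { replace (rho / 2) with (/ 2 * rho) by (unfold Cdiv; ring).
      rewrite <- RtoC_inv by lra; rewrite im_scal_l; lra. }
    pose proof (Im_pos_neq_0 _ hr) as hr0.
    apply summable_le with (fun j : Z => E (- (rho / 2 * (u / rho - 1 / 2) ^ 2))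
       * E (rho / 2 * (IZR j + (u / rho - 1 / 2)) ^ 2)).
    - apply summable_scal, gauss_summable, hr2.
    - intros j; rewrite <- E_plus; apply Req_le; unfold e; do 2 f_equal; field; exact hr0. }
  destruct (Clim_bounded _ _ HQ) as [M [hM HM]].
  pose proof (Clim_inv _ _ hQ0 (fun n => qfac_neq_0 q n hq) HQ) as HQi.
  destruct (Clim_bounded _ _ HQi) as [K [hK HK]].
  set (F := fun (n : nat) (j : Z) =>
     if andb (- Z.of_nat n <=? j)%Z (j <=? Z.of_nat n)%Z
     then qbinom q (2 * n) (Z.to_nat (j + Z.of_nat n)) * e j else RtoC 0).
  enough (A * B = / Q * tsum e) as h by (rewrite h; replace (Q * (/ Q * tsum e)) with (tsum e)
    by (field; exact hQ0); exact He).
  apply Clim_unique with (fun n => Cprod_n (fun i => 1 + E (u + INR i * rho)) n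
    * Cprod_n (fun i => 1 + E ((INR i + 1) * rho - u)) n); [apply Clim_mult; assumption|].
  apply (Tannery F (fun j => / Q * e j) (fun j => RtoC (M * (K * K)) * e j)).
  - apply summable_scal, He.
  - intros n j; assert (0 <= M * (K * K))%R as h0 by (apply Rmult_le_pos; nra).
    rewrite Cmod_mult, Cmod_R, Rabs_pos_eq by exact h0.
    unfold F; destruct (andb _ _);
      [|rewrite Cmod_0; apply Rmult_le_pos; [exact h0|apply Cmod_ge_0]].
    rewrite Cmod_mult; apply Rmult_le_compat_r; [apply Cmod_ge_0|].
    unfold qbinom; destruct (Nat.leb _ _); [|rewrite Cmod_0; exact h0].
    unfold Cdiv; rewrite Cmod_mult; apply Rmult_le_compat; try apply Cmod_ge_0; [apply HM|].
    replace (/ (qfac q (Z.to_nat (j + Z.of_nat n)) * _))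
      with (/ qfac q (Z.to_nat (j + Z.of_nat n))
            * / qfac q (2 * n - Z.to_nat (j + Z.of_nat n)))
      by (field; split; apply qfac_neq_0, hq).
    rewrite Cmod_mult; apply Rmult_le_compat; try apply Cmod_ge_0; apply HK.
  - intros j.
    apply Clim_eventually with (n0 := Z.abs_nat j)
      (u := fun n => qfac q (2 * n) * (/ qfac q (Z.to_nat (j + Z.of_nat n))
         * / qfac q (2 * n - Z.to_nat (j + Z.of_nat n))) * e j).
    + intros n hn; unfold F.
      destruct (Z.leb_spec (- Z.of_nat n) j); [|lia].
      destruct (Z.leb_spec j (Z.of_nat n)); [|lia]; simpl andb; cbv iota.
      unfold qbinom; destruct (Nat.leb_spec (Z.to_nat (j + Z.of_nat n)) (2 * n)); [|lia].
      field; split; apply qfac_neq_0, hq.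
    + replace (/ Q * e j) with (Q * (/ Q * / Q) * e j) by (field; exact hQ0).
      apply Clim_mult; [apply Clim_mult; [|apply Clim_mult]|apply Clim_const].
      * apply (Clim_subseq (qfac q)); [|exact HQ]; intros N; exists N; intros n hn; lia.
      * apply (Clim_subseq (fun n => / qfac q n)); [|exact HQi].
        intros N; exists (N + Z.abs_nat j)%nat; intros n hn; lia.
      * apply (Clim_subseq (fun n => / qfac q n)); [|exact HQi].
        intros N; exists (N + Z.abs_nat j)%nat; intros n hn; lia.
  - intros n; rewrite finite_triple_product by exact hr; fold q.
    replace (lsum _ (seq 0 (S (2 * n)))) with
      (lsum (F n) (map (fun i => (Z.of_nat i - Z.of_nat n)%Z) (seq 0 (S (2 * n))))).
    + apply has_sum_finite.
      * apply NoDup_map_inj; [intros i k; lia|apply seq_NoDup].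
      * intros j hj; unfold F.
        destruct (Z.leb_spec (- Z.of_nat n) j); [|easy].
        destruct (Z.leb_spec j (Z.of_nat n)); [|easy].
        exfalso; apply hj, in_map_iff; exists (Z.to_nat (j + Z.of_nat n)).
        split; [lia|apply in_seq; lia].
    + rewrite lsum_map; apply lsum_ext_in; intros k hk; apply in_seq in hk; unfold F.
      destruct (Z.leb_spec (- Z.of_nat n) (Z.of_nat k - Z.of_nat n)); [|lia].
      destruct (Z.leb_spec (Z.of_nat k - Z.of_nat n) (Z.of_nat n)); [|lia].
      simpl andb; cbv iota.
      replace (Z.to_nat (Z.of_nat k - Z.of_nat n + Z.of_nat n)) with k by lia.
      unfold e; rewrite minus_IZR, RtoC_minus, <- !INR_2_Z; easy.
  - apply has_sum_scal, He.
Qed.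

Lemma E_nat_mul (t : C) (i : nat) : E t * E t ^ i = E (t + INR i * t).
Proof. rewrite E_pow, <- E_plus; easy. Qed.

Lemma qfac_limit (t : C) : (0 < Im t)%R -> exists l : C, l <> 0 /\ Clim (qfac (E t)) l.
Proof.
  intros ht; destruct (Cprod_n_limit (fun i => - (E t * E t ^ i)) (Cmod (E t))) as [l [h0 hl]].
  - apply Cmod_E_lt_1, ht.
  - intros i; rewrite Cmod_opp, <- Cpow_S, Cmod_pow; lra.
  - exists l; split; [exact h0|exact hl].
Qed.

(** The triple product writes [theta_3] as a product of three nonzero limits. *)
Lemma theta3_neq_0 (t : C) : (0 < Im t)%R -> Theta 0 0 t <> 0.
Proof.
  intros ht.
  assert (0 < Im (2 * t))%R as ht2 by (rewrite im_scal_l; lra).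
  destruct (qfac_limit (2 * t) ht2) as [Q [hQ0 HQ]].
  destruct (Cprod_n_limit (fun i => E (t + INR i * (2 * t))) (Cmod (E t))) as [A [hA0 HA]].
  - apply Cmod_E_lt_1, ht.
  - intros i.
    replace (t + INR i * (2 * t)) with (INR (S (2 * i)) * t)
      by (rewrite S_INR, mult_INR, RtoC_plus, RtoC_mult; simpl (INR 2); 
          replace (1 + 1)%R with 2%R by ring; ring).
    rewrite <- E_pow, Cmod_pow.
    pose proof (Cmod_E_lt_1 t ht) as hr.
    replace (S (2 * i)) with (S i + i)%nat by lia; rewrite pow_add.
    rewrite <- (Rmult_1_r (Cmod (E t) ^ S i)) at 2.
    apply Rmult_le_compat_l; [apply pow_le, hr|].
    rewrite <- (pow1 i); apply pow_incr; lra.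
  - assert (has_sum (fun j : Z => E (2 * t * (IZR j * (IZR j - 1) / 2) + IZR j * t))
       (Q * (A * A))) as H.
    { apply triple_product; try assumption.
      eapply Clim_ext; [|exact HA]; intros n; apply Cprod_n_ext; intros i.
      do 2 f_equal; ring. }
    replace (Theta 0 0 t) with (Q * (A * A)); [|symmetry; apply has_sum_tsum].
    + repeat apply Cmult_neq_0; assumption.
    + eapply has_sum_ext; [|exact H]; intros j; cbv beta; f_equal; field.
Qed.

(** Gauss's product: with Euler's identity [(- q ; q) (q ; q ^ 2) = 1] the
    triple product for [theta_2] becomes the quotient that defines [PiQ]. *)
Lemma PiQ_theta (t : C) : (0 < Im t)%R ->
  PiQ t = Theta (1 / 2) 0 (t / 2) ^ 2 / 4.
Proof.
  intros ht; set (q := E t).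
  pose proof (Cmod_E_lt_1 t ht) as hr; fold q in hr.
  assert (0 < Im (2 * t))%R as ht2 by (rewrite im_scal_l; lra).
  assert (0 < Im (t / 2))%R as hth.
  { replace (t / 2) with (/ 2 * t) by (unfold Cdiv; ring).
    rewrite <- RtoC_inv by lra; rewrite im_scal_l; lra. }
  assert (q ^ 2 = E (2 * t)) as hq2 by (unfold q; rewrite E_pow; simpl (INR 2);
    do 2 f_equal; rewrite RtoC_plus; ring).
  destruct (qfac_limit t ht) as [Q [hQ0 HQ]]; fold q in HQ.
  destruct (qfac_limit (2 * t) ht2) as [Q2 [hQ20 HQ2]]; rewrite <- hq2 in HQ2.
  destruct (Cprod_n_limit (fun i => E (t + INR i * t)) (Cmod q)) as [A [hA0 HA]];
    [exact hr|intros i; rewrite <- E_nat_mul; fold q; rewrite <- Cpow_S, Cmod_pow; lra|].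
  destruct (Cprod_n_limit (fun i => - (q * (q ^ 2) ^ i)) (Cmod q)) as [Q1 [hQ10 HQ1]];
    [exact hr| |].
  { intros i; rewrite Cmod_opp, <- Cpow_mult_r, <- Cpow_S, Cmod_pow.
    replace (S (2 * i)) with (S i + i)%nat by lia; rewrite pow_add.
    rewrite <- (Rmult_1_r (Cmod q ^ S i)) at 2.
    apply Rmult_le_compat_l; [apply pow_le, hr|].
    rewrite <- (pow1 i); apply pow_incr; lra. }
  assert (Q * A = Q2) as e1.
  { apply Clim_unique with (qfac (q ^ 2)); [|exact HQ2].
    eapply Clim_ext; [|apply Clim_mult; [exact HQ|exact HA]].
    intros n; cbv beta; unfold qfac; rewrite <- Cprod_n_mul; apply Cprod_n_ext; intros i.
    rewrite <- E_nat_mul; fold q; rewrite <- Cpow_mult_r, (Nat.mul_comm 2), Cpow_mult_r; ring. }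
  assert (Q = Q1 * Q2) as e2.
  { apply Clim_unique with (fun n => qfac q (2 * n)).
    - apply (Clim_subseq (qfac q)); [|exact HQ]; intros N; exists N; intros n hn; lia.
    - eapply Clim_ext; [|apply Clim_mult; [exact HQ1|exact HQ2]].
      intros n; cbv beta; unfold qfac; rewrite <- Cprod_n_mul.
      induction n as [|n IH]; [easy|].
      replace (2 * S n)%nat with (S (S (2 * n))) by lia.
      rewrite !Cprod_n_S, IH.
      rewrite <- !Cpow_mult_r; simpl Cpow; ring. }
  assert (Theta (1 / 2) 0 (t / 2) = E (t / 8) * (Q * (A * (2 * A)))) as HV.
  { apply has_sum_tsum.
    apply has_sum_ext with
      (fun j : Z => E (t / 8) * E (t * (IZR j * (IZR j - 1) / 2) + IZR j * t)).
    - intros j; rewrite <- E_plus; f_equal; field.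
    - apply has_sum_scal, triple_product; try assumption.
      apply Clim_shift; eapply Clim_ext; [|apply Clim_mult; [apply (Clim_const 2)|exact HA]].
      intros n; cbv beta; rewrite Cprod_n_head; f_equal.
      + simpl (INR 0); replace ((0 + 1) * t - t) with (RtoC 0) by ring; rewrite E_0.
        rewrite <- RtoC_plus; f_equal; ring.
      + apply Cprod_n_ext; intros i; rewrite S_INR, RtoC_plus; do 2 f_equal; ring. }
  assert (PiQ t = E (t / 4) * (Q2 ^ 2 / Q1 ^ 2)) as HP.
  { unfold PiQ; change (Cexp (PI * Ci * t)) with q.
    replace (qpow t (1 / 4)) with (E (t / 4)) by (unfold qpow, E; f_equal; field).
    unfold qPochhammer, CProd_inf.
    rewrite (CLim_seq_of_Clim (Cprod_n (fun i => 1 - q ^ 2 * (q ^ 2) ^ i)) Q2 HQ2).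
    rewrite (CLim_seq_of_Clim (Cprod_n (fun i => 1 - q * (q ^ 2) ^ i)) Q1 HQ1); easy. }
  assert (A = / Q1) as hA.
  { assert (Q1 * Q2 * A = Q2) as h by (rewrite <- e2; exact e1).
    transitivity (Q1 * Q2 * A / (Q1 * Q2)); [field; split; assumption|].
    rewrite h; field; split; assumption. }
  rewrite HP, HV.
  replace (E (t / 4)) with (E (t / 8) * E (t / 8)) by (rewrite <- E_plus; f_equal; field).
  rewrite <- e1, hA; field; assumption.
Qed.

(** * Theta identities and the theorem *)

Lemma Im_double (t : C) : (0 < Im t)%R -> (0 < Im (2 * t))%R.
Proof. rewrite im_scal_l; lra. Qed.

(** [Theta_mul] with its arguments in normal form. *)
Lemma Theta_mul_eq (a b x y t c d X Y : C) : (0 < Im t)%R ->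
  a = c + d -> b = c - d -> x + y = X -> x - y = Y ->
  Theta a x t * Theta b y t =
    Theta c X (2 * t) * Theta d Y (2 * t)
    + Theta (c + 1 / 2) X (2 * t) * Theta (d + 1 / 2) Y (2 * t).
Proof.
  intros ht -> -> <- <-; rewrite Theta_mul by exact ht.
  replace ((c + d + (c - d)) / 2) with c by field.
  replace ((c + d - (c - d)) / 2) with d by field.
  replace ((c + d + (c - d) + 1) / 2) with (c + 1 / 2) by field.
  replace ((c + d - (c - d) + 1) / 2) with (d + 1 / 2) by field.
  easy.
Qed.

Lemma Theta_half_plus_half (z t : C) : (0 < Im t)%R -> Theta (1 / 2 + 1 / 2) z t = Theta 0 z t.
Proof. intros ht; rewrite <- (Theta_shift 0) by exact ht; f_equal; field. Qed.

Lemma Theta_zero_plus_half (z t : C) : Theta (0 + 1 / 2) z t = Theta (1 / 2) z t.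
Proof. f_equal; ring. Qed.

Lemma Theta_0_period (z t : C) : (0 < Im t)%R -> Theta 0 (z + 1) t = Theta 0 z t.
Proof.
  intros ht; rewrite Theta_period by exact ht.
  replace (2 * 0) with (RtoC 0) by ring; rewrite E_0; ring.
Qed.

Lemma Theta_half_period (z t : C) : (0 < Im t)%R -> Theta (1 / 2) (z + 1) t = - Theta (1 / 2) z t.
Proof.
  intros ht; rewrite Theta_period by exact ht.
  replace (2 * (1 / 2)) with (RtoC 1) by field; rewrite E_1; ring.
Qed.

(** This is the value at zero of the odd function [theta_1]. *)
Lemma Theta_half_at_half (t : C) : (0 < Im t)%R -> Theta (1 / 2) (1 / 2) t = 0.
Proof.
  intros ht.
  pose proof (Theta_reflect (1 / 2) (1 / 2) t ht) as h1.
  rewrite <- Theta_shift in h1 by exact ht.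
  replace (- (1 / 2) + 1) with (1 / 2) in h1 by field.
  pose proof (Theta_half_period (- (1 / 2)) t ht) as h2; rewrite h1 in h2.
  replace (- (1 / 2) + 1) with (1 / 2) in h2 by field.
  set (v := Theta (1 / 2) (1 / 2) t) in *; transitivity ((v + v) / 2); [field|].
  rewrite h2 at 2; field.
Qed.

Lemma Theta_0_neg_half (t : C) : (0 < Im t)%R -> Theta 0 (0 - 1 / 2) t = Theta 0 (1 / 2) t.
Proof.
  intros ht; rewrite <- (Theta_0_period (0 - 1 / 2)) by exact ht; f_equal; field.
Qed.

(** The next four lemmas express the squares of the theta functions of period
    [t] (for [theta_3] at [z = 0]) linearly by the even functions
    [theta_3 (2 z)] and [theta_2 (2 z)] of period [2 t]; relations between squares thereby become linear algebra. *)
Lemma theta3_sq (t : C) : (0 < Im t)%R ->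
  Theta 0 0 t ^ 2 = Theta 0 0 (2 * t) ^ 2 + Theta (1 / 2) 0 (2 * t) ^ 2.
Proof.
  intros ht; transitivity (Theta 0 0 t * Theta 0 0 t); [ring|].
  rewrite (Theta_mul_eq 0 0 0 0 t 0 0 0 0) by (assumption || ring); rewrite Theta_zero_plus_half; ring.
Qed.

Lemma theta4_sq (z t : C) : (0 < Im t)%R ->
  Theta 0 (z + 1 / 2) t ^ 2
  = Theta 0 (2 * z) (2 * t) * Theta 0 0 (2 * t)
    - Theta (1 / 2) (2 * z) (2 * t) * Theta (1 / 2) 0 (2 * t).
Proof.
  intros ht; pose proof (Im_double t ht).
  transitivity (Theta 0 (z + 1 / 2) t * Theta 0 (z + 1 / 2) t); [ring|].
  rewrite (Theta_mul_eq 0 0 _ _ t 0 0 (2 * z + 1) 0) by (assumption || field).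
  rewrite !Theta_zero_plus_half, Theta_0_period, Theta_half_period by assumption; ring.
Qed.

Lemma theta2_sq (z t : C) : (0 < Im t)%R ->
  Theta (1 / 2) z t ^ 2
  = Theta (1 / 2) (2 * z) (2 * t) * Theta 0 0 (2 * t)
    + Theta 0 (2 * z) (2 * t) * Theta (1 / 2) 0 (2 * t).
Proof.
  intros ht; pose proof (Im_double t ht).
  transitivity (Theta (1 / 2) z t * Theta (1 / 2) z t); [ring|].
  rewrite (Theta_mul_eq (1 / 2) (1 / 2) _ _ t (1 / 2) 0 (2 * z) 0) by (assumption || field).
  rewrite Theta_zero_plus_half, Theta_half_plus_half by assumption; ring.
Qed.

Lemma theta1_sq (z t : C) : (0 < Im t)%R ->
  Theta (1 / 2) (z + 1 / 2) t ^ 2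
  = Theta 0 (2 * z) (2 * t) * Theta (1 / 2) 0 (2 * t)
    - Theta (1 / 2) (2 * z) (2 * t) * Theta 0 0 (2 * t).
Proof.
  intros ht; pose proof (Im_double t ht).
  transitivity (Theta (1 / 2) (z + 1 / 2) t * Theta (1 / 2) (z + 1 / 2) t); [ring|].
  rewrite (Theta_mul_eq (1 / 2) (1 / 2) _ _ t (1 / 2) 0 (2 * z + 1) 0) by (assumption || field).
  rewrite Theta_zero_plus_half, Theta_half_plus_half, Theta_0_period, Theta_half_period by assumption; ring.
Qed.

(** In the Landen type formulas below one of the two terms of the product
    formula vanishes, since [theta_1] is odd, or both terms coincide. *)
Lemma theta3_theta4_landen (t : C) : (0 < Im t)%R ->
  Theta 0 0 t * Theta 0 (1 / 2) t = Theta 0 (1 / 2) (2 * t) ^ 2.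
Proof.
  intros ht; pose proof (Im_double t ht).
  rewrite (Theta_mul_eq 0 0 0 (1 / 2) t 0 0 (1 / 2) (0 - 1 / 2)) by (assumption || ring).
  rewrite Theta_zero_plus_half, Theta_0_neg_half, Theta_half_at_half by assumption; ring.
Qed.

Lemma theta1_theta2_landen (z t : C) : (0 < Im t)%R ->
  Theta (1 / 2) (z + 1 / 2) t * Theta (1 / 2) z t
  = Theta (1 / 2) (2 * z + 1 / 2) (2 * t) * Theta 0 (1 / 2) (2 * t).
Proof.
  intros ht; pose proof (Im_double t ht).
  rewrite (Theta_mul_eq (1 / 2) (1 / 2) _ _ t (1 / 2) 0 (2 * z + 1 / 2) (1 / 2))
    by (assumption || field).
  rewrite Theta_zero_plus_half, Theta_half_plus_half, Theta_half_at_half by assumption; ring.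
Qed.

Lemma theta1_theta4_landen (z t : C) : (0 < Im t)%R ->
  Theta (1 / 2) (z + 1 / 2) t * Theta (1 / 2) 0 t
  = 2 * (Theta (1 / 2) (z + 1 / 2) (2 * t) * Theta 0 (z + 1 / 2) (2 * t)).
Proof.
  intros ht; pose proof (Im_double t ht).
  rewrite (Theta_mul_eq (1 / 2) (1 / 2) _ _ t (1 / 2) 0 (z + 1 / 2) (z + 1 / 2))
    by (assumption || field).
  rewrite Theta_zero_plus_half, Theta_half_plus_half by assumption; ring.
Qed.

Lemma theta2_landen (t : C) : (0 < Im t)%R ->
  Theta (1 / 2) 0 t ^ 2 = 2 * (Theta (1 / 2) 0 (2 * t) * Theta 0 0 (2 * t)).
Proof.
  intros ht; rewrite theta2_sq by exact ht; replace (2 * 0) with (RtoC 0) by ring; ring.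
Qed.

(** Both sides are linear in the values at [2 z] and cubic in the constants of
    period [2 t], by the formulas for the squares. *)
Lemma jacobi_quadratic (z t : C) : (0 < Im t)%R ->
  Theta (1 / 2) z t ^ 2 * Theta 0 (1 / 2) t ^ 2
  = Theta 0 (z + 1 / 2) t ^ 2 * Theta (1 / 2) 0 t ^ 2
    - Theta (1 / 2) (z + 1 / 2) t ^ 2 * Theta 0 0 t ^ 2.
Proof.
  intros ht; replace (Theta 0 (1 / 2) t) with (Theta 0 (0 + 1 / 2) t) by (f_equal; ring).
  rewrite !theta4_sq, theta1_sq, !theta2_sq, theta3_sq by exact ht.
  replace (2 * 0) with (RtoC 0) by ring; ring.
Qed.

(** The other two constants are obtained from [theta_3], by [t + 1] for
    [theta_4] and by inversion for [theta_2]. *)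
Lemma theta4_neq_0 (t : C) : (0 < Im t)%R -> Theta 0 (1 / 2) t <> 0.
Proof.
  intros ht; replace (1 / 2) with (0 + 1 / 2) by ring.
  rewrite <- Theta_0_tau_plus_1 by exact ht; apply theta3_neq_0.
  destruct t; simpl in *; lra.
Qed.

Lemma theta2_neq_0 (t : C) : (0 < Im t)%R -> Theta (1 / 2) 0 t <> 0.
Proof.
  intros ht h; pose proof (theta_inversion t ht) as H; rewrite h, Cmult_0_l in H.
  apply (Cmult_neq_0 _ _ (theta3_neq_0 t ht) (theta4_neq_0 _ (Im_neg_inv t ht)) H).
Qed.

(** The modular step: the ratio of the two products is a ratio of theta
    constants of period [tau], and inversion exchanges [theta_2] and [theta_4]
    up to a factor common to the three constants. *)
Lemma PiQ_ratio (tau : C) : (0 < Im tau)%R ->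
  let s := - (1) / tau in
  1 / 2 * (PiQ tau / PiQ (4 * tau))
  = 2 * (Theta 0 (1 / 2) s * Theta 0 0 s) / (Theta 0 0 s ^ 2 - Theta (1 / 2) 0 s ^ 2)
  /\ Theta 0 0 s ^ 2 - Theta (1 / 2) 0 s ^ 2 <> 0.
Proof.
  intros ht s; pose proof (Im_neg_inv tau ht) as hs; fold s in hs.
  pose proof (Im_pos_neq_0 tau ht) as h0.
  assert (0 < Im (4 * tau))%R as h4 by (rewrite im_scal_l; lra).
  assert (0 < Im (tau / 2))%R as hh.
  { replace (tau / 2) with (/ 2 * tau) by (unfold Cdiv; ring).
    rewrite <- RtoC_inv by lra; rewrite im_scal_l; lra. }
  pose proof (PiQ_theta tau ht) as e1; pose proof (PiQ_theta (4 * tau) h4) as e2.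
  replace (4 * tau / 2) with (2 * tau) in e2 by field.
  rewrite theta2_landen in e1 by exact hh; replace (2 * (tau / 2)) with tau in e1 by field.
  pose proof (theta_inversion tau ht) as I1; fold s in I1.
  pose proof (theta_inversion s hs) as I2.
  replace (- (1) / s) with tau in I2 by (unfold s; field; exact h0).
  pose proof (theta3_sq tau ht) as q3; pose proof (theta4_sq 0 tau ht) as q4.
  replace (0 + 1 / 2) with (1 / 2) in q4 by ring; replace (2 * 0) with (RtoC 0) in q4 by ring.
  pose proof (theta2_neq_0 (2 * tau) (Im_double tau ht)) as n2.
  pose proof (theta3_neq_0 tau ht) as n3; pose proof (theta3_neq_0 s hs) as n3s.
  set (T3 := Theta 0 0 tau) in *; set (T2 := Theta (1 / 2) 0 tau) in *.
  set (T4 := Theta 0 (1 / 2) tau) in *; set (S3 := Theta 0 0 s) in *.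
  set (S2 := Theta (1 / 2) 0 s) in *; set (S4 := Theta 0 (1 / 2) s) in *.
  set (B := Theta (1 / 2) 0 (2 * tau)) in *.
  (* the common factor of the inversion formula; it cancels in the ratio *)
  set (c := T3 / S3).
  assert (T2 = c * S4) as E2.
  { transitivity (T2 * S3 / S3); [field; exact n3s|]; rewrite <- I1; unfold c; field; exact n3s. }
  assert (T4 = c * S2) as E4.
  { transitivity (S3 * T4 / S3); [field; exact n3s|]; rewrite I2; unfold c; field; exact n3s. }
  assert (T3 = c * S3) as E3 by (unfold c; field; exact n3s).
  assert (c <> 0) as nc by (intros h; apply n3; rewrite E3, h; ring).
  assert (2 * B ^ 2 = c ^ 2 * (S3 ^ 2 - S2 ^ 2)) as EB.
  { transitivity (T3 ^ 2 - T4 ^ 2); [rewrite q3, q4; ring|rewrite E3, E4; ring]. }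
  assert (S3 ^ 2 - S2 ^ 2 <> 0) as nd.
  { intros h; rewrite h, Cmult_0_r in EB.
    apply (Cmult_neq_0 2 (B ^ 2)); [intros h2; apply RtoC_inj in h2; lra| |exact EB].
    apply Cpow_nz, n2. }
  split; [|exact nd].
  rewrite e1, e2.
  replace (B ^ 2) with (c ^ 2 * (S3 ^ 2 - S2 ^ 2) / 2) by (rewrite <- EB; field).
  rewrite E2, E3; field; split; assumption.
Qed.

Theorem theorem1 (tau z : C) (Htau : (0 < Im tau)%R) :
  let tau' := - (1) / tau in
  theta1 (2 * z) tau' ^ 2 * theta1 (PI / 2) (tau' / 2) ^ 4
    * theta1 (PI / 2) (tau' / 4) ^ 2
  = (1 / 2 * (PiQ tau / PiQ (4 * tau))) ^ 2
      * theta1 z (tau' / 4) ^ 2 * theta1 (PI / 2) (tau' / 2) ^ 4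
      * theta1 (PI / 2) tau' ^ 2
    - (1 / 2 * (PiQ tau / PiQ (4 * tau))) ^ 2
      * theta1 z (tau' / 2) ^ 4 * theta1 (PI / 2) (tau' / 4) ^ 2
      * theta1 (PI / 2) tau' ^ 2.
Proof.
  intros tau'.
  destruct (PiQ_ratio tau Htau) as [HK nK]; fold tau' in HK, nK.
  pose proof (Im_neg_inv tau Htau) as hs; fold tau' in hs.
  set (w := tau' / 2); set (v := w / 2).
  assert (0 < Im w)%R as hw.
  { unfold w; replace (tau' / 2) with (/ 2 * tau') by (unfold Cdiv; ring).
    rewrite <- RtoC_inv by lra; rewrite im_scal_l; lra. }
  assert (0 < Im v)%R as hv.
  { unfold v; replace (w / 2) with (/ 2 * w) by (unfold Cdiv; ring).
    rewrite <- RtoC_inv by lra; rewrite im_scal_l; lra. }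
  replace (tau' / 4) with v by (unfold v, w; field).
  assert (2 * w = tau') as ew by (unfold w; field).
  assert (2 * v = w) as ev by (unfold v; field).
  assert (RtoC PI <> 0) as hpi
    by (intros h; apply RtoC_inj in h; pose proof PI_RGT_0; lra).
  set (x := z / PI).
  assert (forall s, (0 < Im s)%R -> theta1 (PI / 2) s = Theta (1 / 2) 0 s) as th2.
  { intros s h; replace (PI / 2) with (PI * (1 / 2)) by field.
    rewrite theta1_Theta by exact h; replace (1 / 2 + 1 / 2) with (0 + 1) by field.
    rewrite Theta_half_period by exact h; ring. }
  rewrite !th2 by assumption.
  replace (2 * z) with (PI * (2 * x)) by (unfold x; field; exact hpi).
  replace z with (PI * x) by (unfold x; field; exact hpi).
  rewrite !theta1_Theta by assumption.
  rewrite HK.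
  pose proof (theta1_theta2_landen x w hw) as L12.
  pose proof (theta1_theta4_landen x v hv) as L14.
  pose proof (theta2_landen v hv) as L2; pose proof (theta3_theta4_landen w hw) as L34.
  pose proof (jacobi_quadratic x w hw) as J.
  pose proof (theta2_sq 0 w hw) as q2; pose proof (theta4_sq 0 w hw) as q4.
  replace (0 + 1 / 2) with (1 / 2) in q4 by ring; replace (2 * 0) with (RtoC 0) in q2, q4 by ring.
  pose proof (theta2_neq_0 v hv) as nC; pose proof (theta4_neq_0 tau' hs) as nD.
  pose proof (theta4_neq_0 w hw) as n4; pose proof (theta2_neq_0 w hw) as n2.
  pose proof (theta3_neq_0 w hw) as n3.
  rewrite ew in *; rewrite ev in *.
  set (X := Theta (1 / 2) (2 * x + 1 / 2) tau') in *; set (Y := Theta (1 / 2) (x + 1 / 2) v) in *.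
  set (S := Theta (1 / 2) (x + 1 / 2) w) in *; set (U := Theta (1 / 2) x w) in *.
  set (W := Theta 0 (x + 1 / 2) w) in *; set (t2 := Theta (1 / 2) 0 w) in *.
  set (t3 := Theta 0 0 w) in *; set (t4 := Theta 0 (1 / 2) w) in *.
  set (c := Theta (1 / 2) 0 v) in *; set (D := Theta 0 (1 / 2) tau') in *.
  set (A := Theta 0 0 tau') in *; set (B := Theta (1 / 2) 0 tau') in *.
  (* from here on everything is reduced to the theta functions of period [w] *)
  assert (A ^ 2 - B ^ 2 = t4 ^ 2) as e4 by (rewrite q4; ring).
  rewrite e4.
  assert (X ^ 2 = S ^ 2 * (W ^ 2 * t2 ^ 2 - S ^ 2 * t3 ^ 2) / (t3 * t4 * t4 ^ 2)) as eX.
  { rewrite L34, <- J; transitivity ((X * D) ^ 2 / D ^ 2); [field; exact nD|].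
    rewrite <- L12; field; split; assumption. }
  assert (Y ^ 2 = 2 * (S ^ 2 * W ^ 2) / (t2 * t3)) as eY.
  { transitivity ((Y * c) ^ 2 / c ^ 2); [field; exact nC|].
    rewrite L14, L2; field; split; assumption. }
  assert ((2 * (D * A) / t4 ^ 2) ^ 2 * B ^ 2 = t3 * t2 ^ 4 / t4 ^ 3) as eK.
  { transitivity (D ^ 2 * (2 * (B * A)) ^ 2 / t4 ^ 4); [field; exact n4|].
    rewrite <- L34; replace (2 * (B * A)) with (t2 ^ 2) by (rewrite q2; ring).
    field; exact n4. }
  transitivity ((2 * (D * A) / t4 ^ 2) ^ 2 * B ^ 2 * (Y ^ 2 * t2 ^ 4 - (S ^ 2) ^ 2 * c ^ 2));
    [|ring].
  rewrite eK, eY, L2.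
  replace ((- X) ^ 2) with (X ^ 2) by ring; rewrite eX.
  field; repeat split; assumption.
Qed.
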